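(* Let $(R,\mathfrak m)$ be a Noetherian local ring and $M$ a finite $R$-module of dimension $d>0$. Let $\mathbf x=x_1,\ldots,x_r$ ($0\le r\le d$) be an amenable partial system of parameters of $M$ that is a $d$-sequence relative to $M$. Set $h_i=\lambda(\mathrm H_i(\mathbf x;M))$ for $i>0$ and $h_0=\lambda(\mathrm H^0_{\mathfrak m}(\mathrm H_0(\mathbf x;M)))$. Then: (1) The Hilbert series of the $\mathbf j$-transform $\mathrm H=\mathrm H^0_{\mathfrak m}(\operatorname{gr}_{(\mathbf x)}(M))$ is $$[\![\mathrm H]\!]=\frac{\sum_{i=0}^r(-1)^ih_it^i}{(1-t)^r},$$ and the $\mathbf j$-polynomial of $M$ with respect to $\mathbf x$ is $$\sum_{i=0}^r(-1)^i\,\mathrm j_i(\mathbf x;M)\binom{n+r-i}{r-i},\qquad\text{where}\quad \mathrm j_i(\mathbf x;M)=\sum_{k=i}^r(-1)^kh_k\binom{k}{i}.$$ In particular, $\mathrm j_0(\mathbf x;M)=\sum_{k=0}^r(-1)^kh_k$ and $\mathrm j_1(\mathbf x;M)=\sum_{k=1}^r(-1)^k\,k\,h_k$. (2) $\mathbf x$ is an $M$-regular sequence if and only if $\mathrm j_1(\mathbf x;M)=\cdots=\mathrm j_r(\mathbf x;M)=0$.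
   Context: ''Finite'' module means finitely generated; $\lambda(-)$ is length; $\mathrm H_i(\mathbf x;M)$ is Koszul homology, so $\mathrm H_0(\mathbf x;M)=M/(\mathbf x)M$. A partial system of parameters of $M$ is a sequence $x_1,\ldots,x_r\in\mathfrak m$ with $\dim M=r+\dim M/(x_1,\ldots,x_r)M$; it is amenable to $M$ if $\mathrm H_i(\mathbf x;M)$ has finite length for all $i>0$. A sequence $x_1,\ldots,x_n$ is a $d$-sequence relative to $M$ if $(x_1,\ldots,x_{i-1})M:_M x_ix_j=(x_1,\ldots,x_{i-1})M:_M x_j$ for all $1\le i\le j\le n$. $\operatorname{gr}_I(M)=\bigoplus_{n\ge0}I^nM/I^{n+1}M$. For $I=(\mathbf x)$ and $\mathrm H=\mathrm H^0_{\mathfrak m}(\operatorname{gr}_I(M))=\bigoplus_{k\ge0}\mathrm H_k$ (grading inherited from $\operatorname{gr}_I(M)$), the Hilbert series is $[\![\mathrm H]\!]=\sum_{k\ge0}\lambda(\mathrm H_k)t^k$. The $\mathbf j$-function is $\psi^M_I(n)=\sum_{k\le n}\lambda(\mathrm H_k)$, and the $\mathbf j$-polynomial is the polynomial agreeing with it for $n\gg0$, written $\sum_{i=0}^r(-1)^i\mathrm j_i(\mathbf x;M)\binom{n+r-i}{r-i}$; the integers $\mathrm j_i(\mathbf x;M)$ are the $\mathbf j$-coefficients. *)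

(* Defs.v *)
From mathcomp Require Import all_boot all_order all_algebra.
From mathcomp Require Import boolp classical_sets.

Set Implicit Arguments.
Unset Strict Implicit.
Unset Printing Implicit Defensive.

Import GRing.Theory.

Local Open Scope classical_set_scope.
Local Open Scope ring_scope.

(* [max_chain A n]: n is the maximal length of a strictly increasing chain
   C 0 < ... < C n of members of A. *)
Definition chain (T : Type) (A : set (set T)) (n : nat) : Prop :=
  exists C : nat -> set T,
    (forall i, (i <= n)%N -> A (C i)) /\
    (forall i, (i < n)%N -> C i `<` C i.+1).

Definition max_chain (T : Type) (A : set (set T)) (n : nat) : Prop :=
  chain A n /\ forall k, chain A k -> (k <= n)%N.

(** Ideals and submodules *)

(* Ideals, possibly improper, are the submodules of R^o; the library predicate
   [idealr_closed] means "proper ideal". *)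
Definition submodule (R : comNzRingType) (V : lmodType R) (N : set V) : Prop :=
  submod_closed [in N].

Definition lspan (R : comNzRingType) (V : lmodType R) (s : seq V) : set V :=
  [set v | exists a : nat -> R, v = \sum_(i < size s) a i *: s`_i].

Definition ideal_gen (R : comNzRingType) (s : seq R) : set R :=
  lspan (s : seq R^o).

Definition maximal_ideal (R : comNzRingType) (J : set R) : Prop :=
  idealr_closed [in J] /\
  forall K : set R, idealr_closed [in K] -> J `<=` K -> K = J.

Definition prime_ideal (R : comNzRingType) (P : set R) : Prop :=
  idealr_closed [in P] /\ prime_idealr_closed [in P].

Definition noetherian (R : comNzRingType) : Prop :=
  forall I : set R^o, submodule I -> exists s : seq R^o, I = lspan s.

Definition local_ring (R : comNzRingType) (m : set R) : Prop :=
  forall J : set R, maximal_ideal J <-> J = m.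

Definition finite_module (R : comNzRingType) (M : lmodType R) : Prop :=
  exists s : seq M, lspan s = setT.

Definition ideal_smul (R : comNzRingType) (V : lmodType R)
    (I : set R) (N : set V) : set V :=
  [set v | exists n (a : 'I_n -> R) (w : 'I_n -> V),
     [/\ forall k, I (a k), forall k, N (w k) & v = \sum_k a k *: w k]].

(* I^n V; for V := R^o this is the ideal I^n. *)
Definition pow_smul (R : comNzRingType) (V : lmodType R) (I : set R) (n : nat)
  : set V := iter n (ideal_smul I) setT.
Arguments pow_smul {R} V I n _.

Definition seq_smul (R : comNzRingType) (M : lmodType R) (s : seq R) : set M :=
  ideal_smul (ideal_gen s) setT.
Arguments seq_smul {R} M s _.

Definition colon (R : comNzRingType) (M : lmodType R) (N : set M) (a : R)
  : set M := [set v | N (a *: v)].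

(** Subquotients *)

(* [SubQuo A B] stands for the module A / B, where B <= A are submodules of V.
   Submodules of A / B are given by the submodules of V between B and A. *)
Record subquo (R : comNzRingType) (V : lmodType R) :=
  SubQuo { sq_num : set V ; sq_den : set V }.

Definition whole (R : comNzRingType) (V : lmodType R) : subquo V :=
  SubQuo setT [set 0].
Arguments whole {R} V.

Definition quo (R : comNzRingType) (V : lmodType R) (N : set V) : subquo V :=
  SubQuo setT N.

Definition sq_submodules (R : comNzRingType) (V : lmodType R) (Q : subquo V)
  : set (set V) :=
  [set N | [/\ submodule N, sq_den Q `<=` N & N `<=` sq_num Q]].

Definition finite_length (R : comNzRingType) (V : lmodType R) (Q : subquo V)
  : Prop := exists n, max_chain (sq_submodules Q) n.

(* The value is 0 if Q does not have finite length. *)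
Definition sq_length (R : comNzRingType) (V : lmodType R) (Q : subquo V) : nat :=
  xget 0%N [set n | max_chain (sq_submodules Q) n].

Definition ann (R : comNzRingType) (V : lmodType R) (Q : subquo V) : set R :=
  [set a | forall v, sq_num Q v -> sq_den Q (a *: v)].

(* dim Q = d, as the Krull dimension of R / ann Q; no d qualifies for Q = 0. *)
Definition is_dim (R : comNzRingType) (V : lmodType R) (Q : subquo V) (d : nat)
  : Prop := max_chain [set P | prime_ideal P /\ ann Q `<=` P] d.

(* H^0_m(Q): the elements of Q annihilated by some power of m. *)
Definition H0m (R : comNzRingType) (V : lmodType R) (m : set R) (Q : subquo V)
  : subquo V :=
  SubQuo [set v | sq_num Q v /\ exists k, forall a : R,
                    pow_smul R^o m k a -> sq_den Q (a *: v)]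
         (sq_den Q).

(** Koszul homology *)

(* The Koszul complex K(x; M) is realized on functions f from subsets of 'I_r
   to M, f standing for \sum_S f S (x) e_S; degree p is spanned by the e_S with
   #|S| = p, and d(e_S) = \sum_(i in S) (-1)^#{j in S | j < i} x_i e_(S \ i). *)
Definition koszul_space (R : comNzRingType) (M : lmodType R) (r : nat) :
  lmodType R := {ffun {set 'I_r} -> M}.

Definition koszul_d (R : comNzRingType) (M : lmodType R) (r : nat)
    (x : r.-tuple R) (f : koszul_space M r) : koszul_space M r :=
  [ffun T : {set 'I_r} => \sum_(i | i \notin T)
     ((-1) ^+ #|[pred j in T | (j < i)%N]| * tnth x i) *: f (i |: T)%SET].

Definition koszul_chains (R : comNzRingType) (M : lmodType R) (r p : nat)
  : set (koszul_space M r) :=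
  [set f : {ffun {set 'I_r} -> M} | forall S : {set 'I_r}, #|S| != p -> f S = 0].

Definition koszul_homology (R : comNzRingType) (M : lmodType R) (r : nat)
    (x : r.-tuple R) (p : nat) : subquo (koszul_space M r) :=
  SubQuo (koszul_chains p `&` [set f | koszul_d x f = 0])
         (koszul_d x @` koszul_chains p.+1).
Arguments koszul_homology {R} M {r} x p.

(** Properties of sequences, indexed from 0: [take i x] is x_0, ..., x_(i-1) *)

Definition partial_sop (R : comNzRingType) (M : lmodType R) (m : set R)
    (r : nat) (x : r.-tuple R) : Prop :=
  (forall i, m (tnth x i)) /\
  exists e, is_dim (whole M) (r + e) /\ is_dim (quo (seq_smul M x)) e.

Definition amenable (R : comNzRingType) (M : lmodType R)
    (r : nat) (x : r.-tuple R) : Prop :=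
  forall i, (0 < i)%N -> finite_length (koszul_homology M x i).

Definition d_sequence (R : comNzRingType) (M : lmodType R)
    (r : nat) (x : r.-tuple R) : Prop :=
  forall i j : 'I_r, (i <= j)%N ->
    colon (seq_smul M (take i x)) (tnth x i * tnth x j) =
    colon (seq_smul M (take i x)) (tnth x j).

Definition regular_sequence (R : comNzRingType) (M : lmodType R)
    (r : nat) (x : r.-tuple R) : Prop :=
  (forall i : 'I_r, colon (seq_smul M (take i x)) (tnth x i) =
                    seq_smul M (take i x)) /\
  seq_smul M x <> setT.

(** The j-transform and its numerical invariants *)

Definition gr (R : comNzRingType) (M : lmodType R) (I : set R) (k : nat)
  : subquo M := SubQuo (pow_smul M I k) (pow_smul M I k.+1).
Arguments gr {R} M I k.

(* R acts on gr_I(M) in degree 0, so H^0_m is taken degree by degree. *)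
Definition j_transform (R : comNzRingType) (M : lmodType R) (m I : set R)
    (k : nat) : subquo M := H0m m (gr M I k).
Arguments j_transform {R} M m I k.

Definition j_hilbert (R : comNzRingType) (M : lmodType R) (m I : set R)
    (k : nat) : nat := sq_length (j_transform M m I k).

Definition j_function (R : comNzRingType) (M : lmodType R) (m I : set R)
    (n : nat) : nat := (\sum_(k < n.+1) j_hilbert M m I k)%N.

Definition agrees_eventually (f : nat -> nat) (p : {poly rat}) : Prop :=
  exists N, forall n, (N <= n)%N -> p.[n%:R] = (f n)%:R.

Definition j_polynomial (R : comNzRingType) (M : lmodType R) (m I : set R)
  : {poly rat} := xget 0 [set p | agrees_eventually (j_function M m I) p].

(* The polynomial binomial(X + k, k) = (X + 1) ... (X + k) / k! *)
Definition binp (k : nat) : {poly rat} :=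
  (k`!%:R)^-1 *: \prod_(l < k) ('X + (l.+1%:R)%:P).

Definition binp_expansion (r : nat) (c : 'I_r.+1 -> int) : {poly rat} :=
  \sum_(i < r.+1) ((-1) ^+ i * (c i)%:~R) *: binp (r - i).

Definition j_coef (R : comNzRingType) (M : lmodType R) (m : set R)
    (r : nat) (x : r.-tuple R) : {ffun 'I_r.+1 -> int} :=
  xget 0 [set c : {ffun 'I_r.+1 -> int} |
           j_polynomial M m (ideal_gen x) = binp_expansion c].

Definition koszul_h (R : comNzRingType) (M : lmodType R) (m : set R)
    (r : nat) (x : r.-tuple R) (i : nat) : nat :=
  if i == 0%N then sq_length (H0m m (koszul_homology M x 0))
  else sq_length (koszul_homology M x i).

(* u = p / q in Z[[t]]; meaningful when q is invertible there, i.e. when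
   q`_0 is 1 or -1. *)
Definition is_series_of (u : nat -> int) (p q : {poly int}) : Prop :=
  forall n, \sum_(i < n.+1) u i * q`_(n - i) = p`_n.

(* Main.v *)
Require Import Defs.
From mathcomp Require Import all_boot all_order all_algebra.
From mathcomp Require Import boolp classical_sets.
From mathcomp Require Import zify ring.

(** Write I = (x) and h_i, g_k for the lengths of H_i(x; M) (of its m-torsion if
    i = 0) and of the m-torsion of I^k M / I^(k+1) M. Everything follows from an
    induction on r that removes the first member x_0 of the d-sequence.

    Let N = 0 :_M x_0. The d-sequence property gives I N = 0 and N /\ I M = 0, and
    x_0 is regular on M / N. Hence N has finite length, being the top Koszul
    homology of M; replacing M by M / N lowers g_0 by the length l of N, keeps
    the other g_k, and lowers h_i by C(r, i) l. Next, x_0 is a nonzerodivisor of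
    degree one on the graded module of M / N, because I^(k+1) (M/N) : x_0 =
    I^k (M/N) ([dseq_filt_regular]), and its cokernel is the graded module of
    M'' = M / (N + x_0 M) for the d-sequence x_1, ..., x_(r-1). The functor H^0_m
    keeps the resulting sequence exact on the right because the torsion of the
    graded module of M'' is generated in degree zero, a property carried along the
    induction ([torsion_generated]). So the series of the g_k for M / N is that of
    M'' divided by 1 - t ([gr_length_quoS]), while the Koszul homology of M'' is
    that of M modulo the contribution of N ([koszul_length_fst]). Both sides of
    (1 - t)^r Sum g_k t^k = Sum (-1)^i h_i t^i therefore grow by l (1 - t)^r when
    M'' is replaced by M, and for r = 0 the formula is trivial.

    Rewriting the numerator in powers of 1 - t gives the partial sums of the g_k
    as Sum (-1)^i j_i C(n + r - i, r - i), for every n. All j_i with i > 0 vanish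
    exactly when the numerator is constant, that is when h_i = 0 for all i > 0;
    along the induction this says that l = 0 at every step, i.e. that x is regular.

    No quotient module is formed: M / L is studied through submodules of M
    containing L, and each step of the induction enlarges L. *)

Set Implicit Arguments.
Unset Strict Implicit.
Unset Printing Implicit Defensive.

Import GRing.Theory.

Local Open Scope ring_scope.

(** * Submodules *)

Section Submodules.
Variables (R : comNzRingType) (V : lmodType R).
Implicit Types (A B C N : set V) (u v w : V).

Lemma submoduleP N :
  submodule N <-> N 0 /\ (forall a u v, N u -> N v -> N (a *: u + v)).
Proof.
split=> [[N0 NZ]|[N0 NZ]]; split; first by rewrite inE in N0.
- by move=> a u v Nu Nv; have /(_ a u v) := NZ; rewrite !inE; apply.
- by rewrite inE.
- by move=> a u v; rewrite !inE; apply: NZ.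
Qed.

Lemma sub0 N : submodule N -> N 0.
Proof. by case/submoduleP. Qed.

Lemma subZ N a v : submodule N -> N v -> N (a *: v).
Proof.
case/submoduleP=> N0 NZ Nv.
by have := NZ a v 0 Nv N0; rewrite addr0.
Qed.

Lemma subD N u v : submodule N -> N u -> N v -> N (u + v).
Proof.
by case/submoduleP=> _ NZ Nu Nv; have := NZ 1 u v Nu Nv; rewrite scale1r.
Qed.

Lemma subN N v : submodule N -> N v -> N (- v).
Proof. by move=> sN Nv; rewrite -scaleN1r; apply: subZ. Qed.

Lemma subB N u v : submodule N -> N u -> N v -> N (u - v).
Proof. by move=> sN Nu Nv; apply: subD => //; apply: subN. Qed.

Lemma subBr N u v : submodule N -> N v -> N (u - v) -> N u.
Proof. by move=> sN Nv Nuv; rewrite -(subrK v u); apply: subD. Qed.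

Lemma sub_sum N (I : Type) (s : seq I) (P : pred I) (F : I -> V) :
  submodule N -> (forall i, P i -> N (F i)) -> N (\sum_(i <- s | P i) F i).
Proof.
move=> sN NF; elim/big_ind: _ => //; first exact: sub0.
by move=> u v; apply: subD.
Qed.

Lemma submodule_setT : submodule (@setT V).
Proof. exact/submoduleP. Qed.

Lemma submodule_set0 : submodule [set (0 : V)]%classic.
Proof.
by apply/submoduleP; split=> // a u v /= -> ->; rewrite scaler0 addr0.
Qed.

Lemma submoduleI A B : submodule A -> submodule B -> submodule (A `&` B)%classic.
Proof.
move=> /submoduleP[A0 AZ] /submoduleP[B0 BZ]; apply/submoduleP; split=> //.
by move=> a u v [Au Bu] [Av Bv]; split; [apply: AZ|apply: BZ].
Qed.

End Submodules.

Section ImagePlus.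
Variables (R : comNzRingType) (V V' : lmodType R).
Implicit Types (phi : V -> V') (A : set V) (C : set V').

(** The submodule phi(A) + C. Sums A + B are the case where phi is the
    identity, and a A + B the case of a homothety. *)
Definition image_plus phi A C : set V' :=
  [set v | exists2 u, A u & C (v - phi u)]%classic.

Lemma lin0 phi : linear phi -> phi 0 = 0.
Proof.
move=> lphi; have := lphi 1 0 0; rewrite !scale1r addr0 => e.
by apply: (addrI (phi 0)); rewrite -e addr0.
Qed.

Lemma linD phi u v : linear phi -> phi (u + v) = phi u + phi v.
Proof. by move=> lphi; have := lphi 1 u v; rewrite !scale1r. Qed.

Lemma linZ phi a v : linear phi -> phi (a *: v) = a *: phi v.
Proof. by move=> lphi; have := lphi a v 0; rewrite (lin0 lphi) !addr0. Qed.

Lemma linB phi u v : linear phi -> phi (u - v) = phi u - phi v.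
Proof. by move=> lphi; rewrite linD // -scaleN1r linZ // scaleN1r. Qed.

Lemma submodule_image_plus phi A C :
  linear phi -> submodule A -> submodule C -> submodule (image_plus phi A C).
Proof.
move=> lphi sA sC; apply/submoduleP; split=> [|a u v].
  by exists 0; [exact: sub0 | rewrite (lin0 lphi) subr0; exact: sub0].
move=> [u' Au' Cu] [v' Av' Cv]; exists (a *: u' + v').
  by apply: subD => //; apply: subZ.
rewrite lphi opprD addrACA -scalerBr.
by apply: subD => //; apply: subZ.
Qed.

Lemma image_plus_subr phi A C :
  linear phi -> submodule A -> (C `<=` image_plus phi A C)%classic.
Proof.
move=> lphi sA v Cv; exists 0; first exact: sub0.
by rewrite (lin0 lphi) subr0.
Qed.

Lemma mem_image_plus phi A C u : submodule C -> A u -> image_plus phi A C (phi u).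
Proof. by move=> sC Au; exists u; rewrite // subrr; apply: sub0. Qed.

Lemma submodule_preim phi C :
  linear phi -> submodule C -> submodule (phi @^-1` C)%classic.
Proof.
move=> lphi sC; apply/submoduleP; split=> [|a u v Cu Cv].
  by rewrite /preimage /= (lin0 lphi); apply: sub0.
by rewrite /preimage /= lphi; apply: subD => //; apply: subZ.
Qed.

End ImagePlus.

Lemma linear_id (R : comNzRingType) (V : lmodType R) : linear (@id V).
Proof. by []. Qed.

Lemma linear_scale (R : comNzRingType) (V : lmodType R) (a : R) :
  linear (fun v : V => a *: v).
Proof. by move=> b u v; rewrite scalerDr !scalerA mulrC. Qed.

#[local] Hint Resolve linear_id linear_scale submodule_setT submodule_set0 : core.

(** * Length *)

Definition has_length (R : comNzRingType) (V : lmodType R) (A C : set V) n :=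
  max_chain (sq_submodules (SubQuo A C)) n.

Section MaxChains.
Variables (T : Type) (S : set (set T)).

Lemma max_chain_uniq n n' : max_chain S n -> max_chain S n' -> n = n'.
Proof.
move=> [ch mx] [ch' mx']; apply/eqP; rewrite eqn_leq.
by rewrite (mx' _ ch) (mx _ ch').
Qed.

Lemma max_chain_of_bound b :
  (exists X, S X) -> (forall k, chain S k -> (k <= b)%N) ->
  exists n, max_chain S n.
Proof.
move=> [X SX] bd.
have ex : exists n, `[< chain S n >].
  by exists 0%N; apply/asboolP; exists (fun=> X).
have ub n : `[< chain S n >] -> (n <= b)%N by move/asboolP; apply: bd.
case: (ex_maxnP ex ub) => n /asboolP ch mx.
by exists n; split=> // k chk; apply: mx; apply/asboolP.
Qed.

(** Skipping the constant steps of a weakly increasing family leaves a chain, so a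
    bound on the length of chains bounds the number of strict steps. *)
Lemma weak_chain k (D : nat -> set T) :
  (forall i, (i <= k)%N -> S (D i)) ->
  (forall i, (i < k)%N -> (D i `<=` D i.+1)%classic) ->
  exists C : nat -> set T,
    [/\ forall i, (i <= \sum_(j < k) `[< D j <> D j.+1 >])%N -> S (C i),
        forall i, (i < \sum_(j < k) `[< D j <> D j.+1 >])%N ->
          (C i `<` C i.+1)%classic &
        C (\sum_(j < k) `[< D j <> D j.+1 >])%N = D k].
Proof.
elim: k => [|k IH] SD leD.
  by exists D; rewrite big_ord0; split=> // i; rewrite leqn0 => /eqP ->; apply: SD.
have SDk i : (i <= k)%N -> S (D i) by move=> ik; apply: SD; lia.
have leDk i : (i < k)%N -> (D i `<=` D i.+1)%classic by move=> ik; apply: leD; lia.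
have [C [SC ltC CD]] := IH SDk leDk.
rewrite big_ord_recr /=; set s := (\sum_(j < k) _)%N in SC ltC CD *.
case: asboolP => [neD|/contrapT eqD]; last first.
  by exists C; rewrite addn0 CD.
rewrite addn1.
exists (fun i => if (i <= s)%N then C i else D k.+1); split.
- by move=> i ile; case: ifP => ?; [apply: SC | apply: SD].
- move=> i; rewrite ltnS => ile; rewrite ile.
  have [lt|ge] := ltnP i s; first exact: ltC.
  have -> : i = s by apply/eqP; rewrite eqn_leq ile ge.
  rewrite CD; split; first exact: leD.
  by move=> sub; apply: neD; apply/seteqP; split=> //; apply: leD.
- by rewrite ltnn.
Qed.

Lemma weak_chain_bound k n (D : nat -> set T) : max_chain S n ->
  (forall i, (i <= k)%N -> S (D i)) ->
  (forall i, (i < k)%N -> (D i `<=` D i.+1)%classic) ->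
  (\sum_(j < k) `[< D j <> D j.+1 >] <= n)%N.
Proof.
move=> [_ mx] SD leD; apply: mx.
by have [C [SC ltC _]] := weak_chain SD leD; exists C.
Qed.

End MaxChains.

Section Length.
Variables (R : comNzRingType) (V : lmodType R).
Implicit Types (A B C : set V).
Local Open Scope classical_set_scope.

Lemma has_length_uniq A C n n' : has_length A C n -> has_length A C n' -> n = n'.
Proof. exact: max_chain_uniq. Qed.

Lemma sq_length_eq A C n : has_length A C n -> sq_length (SubQuo A C) = n.
Proof.
move=> hn; rewrite /sq_length; case: xgetP => [k _ hk|/(_ n)] //.
exact: max_chain_uniq hk hn.
Qed.

Lemma has_length_refl A : submodule A -> has_length A A 0.
Proof.
move=> sA; split; first by exists (fun=> A); split=> // i _; split.
move=> k [C [SC ltC]]; case: k => // k in SC ltC *.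
have [_ AC0 CA0] := SC 0%N isT; have [_ AC1 CA1] := SC 1%N isT.
have [_ []] := ltC 0%N isT.
exact: subset_trans AC0.
Qed.

Lemma has_length0 A C : submodule A -> submodule C -> C `<=` A ->
  has_length A C 0 -> A = C.
Proof.
move=> sA sC CA [_ mx]; apply/seteqP; split=> //.
apply: contrapT => nAC.
suff : (1 <= 0)%N by [].
apply: mx; exists (fun i => if i == 0%N then C else A); split.
  by move=> i _; case: ifP => _; split.
by case=> // _; split.
Qed.

Lemma has_length_le1 A C : submodule A -> submodule C -> C `<=` A ->
  (forall D, submodule D -> C `<=` D -> D `<=` A -> D = C \/ D = A) ->
  exists n, has_length A C n.
Proof.
move=> sA sC CA simple; apply: (@max_chain_of_bound _ _ 1); first by exists C; split.
move=> [|[|k]] // [D [SD ltD]].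
have [s0 C0 A0] := SD 0%N isT; have [s1 C1 A1] := SD 1%N isT.
have [s2 C2 A2] := SD 2%N isT.
have [le01 nle01] := ltD 0%N isT; have [le12 nle12] := ltD 1%N isT.
case: (simple _ s1 C1 A1) => e; first by case: nle01; rewrite e.
by case: nle12; rewrite e.
Qed.

Lemma has_length_sub A B C n : submodule A -> submodule B -> submodule C ->
  C `<=` B -> B `<=` A -> has_length A C n -> exists k, has_length B C k.
Proof.
move=> sA sB sC CB BA [_ mx]; apply: (@max_chain_of_bound _ _ n); first by exists B; split.
move=> k [D [SD ltD]]; apply: mx; exists D; split=> // i ik.
by have [s C' B'] := SD i ik; split=> //; apply: subset_trans BA.
Qed.

Lemma has_length_quo A B C n : submodule A -> submodule B -> submodule C ->
  C `<=` B -> B `<=` A -> has_length A C n -> exists k, has_length A B k.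
Proof.
move=> sA sB sC CB BA [_ mx]; apply: (@max_chain_of_bound _ _ n); first by exists B; split.
move=> k [D [SD ltD]]; apply: mx; exists D; split=> // i ik.
by have [s C' B'] := SD i ik; split=> //; apply: subset_trans C'.
Qed.

(** The modular law: D is determined, among the submodules comparable with it,
    by its trace on B and its image modulo B. *)
Lemma modular_eq B D D' : submodule B -> submodule D -> submodule D' -> D `<=` D' ->
  D `&` B = D' `&` B -> image_plus id D B = image_plus id D' B -> D = D'.
Proof.
move=> sB sD sD' DD' eI eP; apply/seteqP; split=> // v D'v.
have : image_plus id D' B v by exists v; rewrite // subrr; exact: sub0.
rewrite -eP => -[u Du Bvu].
have : (D' `&` B) (v - u) by split=> //; apply: subB => //; apply: DD'.
by rewrite -eI => -[Dvu _]; apply: subBr Dvu.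
Qed.

Lemma has_lengthD A B C a b : submodule A -> submodule B -> submodule C ->
  C `<=` B -> B `<=` A -> has_length A B a -> has_length B C b ->
  has_length A C (a + b).
Proof.
move=> sA sB sC CB BA hAB hBC; split.
  have [[D [SD ltD]] _] := hBC; have [[E [SE ltE]] _] := hAB.
  (* B lies between the last member of the lower chain and the first member of the
     upper one, and takes the place of both *)
  exists (fun i => if (i < b)%N then D i else
          if i == b then B else E (i - b)%N); split.
    move=> i iab; case: ifP => ib.
      by have [s1 s2 s3] := SD i (ltnW ib); split=> //; apply: subset_trans BA.
    case: ifP => _; first by split.
    have [|s1 s2 s3] := SE (i - b)%N; first by lia.
    by split=> //; apply: subset_trans s2.
  move=> i iab; have [ib|bi] := ltnP i b.
    have [_ _ DB] := SD i.+1 ib; have [D1 D2] := ltD i ib.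
    case: (ltnP i.+1 b) => [//|bi1]; have -> : (i.+1 == b) = true by lia.
    by split=> [|BD]; [exact: subset_trans DB | apply: D2; apply: subset_trans BD].
  have -> : (i.+1 < b)%N = false by lia.
  have -> : (i.+1 == b) = false by lia.
  have [E1 nE1] : E (i - b)%N `<` E (i - b).+1 by apply: ltE; lia.
  have [|_ /= BE _] := SE (i - b)%N; first by lia.
  rewrite subSn //; case: eqP => _; last by split.
  by split=> [|EB]; [exact: subset_trans E1 | apply: nE1; apply: subset_trans BE].
move=> k [D [SD ltD]].
have SDB i : (i <= k)%N -> sq_submodules (SubQuo B C) (D i `&` B).
  move=> ik; have [s CD DA] := SD i ik; split; first exact: submoduleI.
    by move=> v Cv; split; [apply: CD | apply: CB].
  by move=> v [].
have SDA i : (i <= k)%N -> sq_submodules (SubQuo A B) (image_plus id (D i) B).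
  move=> ik; have [s CD DA] := SD i ik; split.
  - exact: submodule_image_plus.
  - exact: image_plus_subr.
  - by move=> v [u /DA Au /BA Avu]; apply: subBr Avu.
have leI i : (i < k)%N -> D i `&` B `<=` D i.+1 `&` B.
  by move=> ik v [Dv Bv]; split=> //; have [+ _] := ltD i ik; apply.
have leP i : (i < k)%N -> image_plus id (D i) B `<=` image_plus id (D i.+1) B.
  by move=> ik v [u Du Bu]; exists u => //; have [+ _] := ltD i ik; apply.
have bB := weak_chain_bound hBC SDB leI; have bA := weak_chain_bound hAB SDA leP.
apply: leq_trans (leq_add bA bB); rewrite -big_split /=.
rewrite -[leqLHS]muln1 -[k in leqLHS]card_ord -sum_nat_const.
apply: leq_sum => i _; have [D1 D2] := ltD i (ltn_ord i).
case: asboolP => // /contrapT eP; case: asboolP => // /contrapT eI.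
case: D2; have [sDi _ _] := SD i (ltnW (ltn_ord i)).
have [sDi1 _ _] := SD i.+1 (ltn_ord i).
by rewrite -(modular_eq sB sDi sDi1 D1 eI eP).
Qed.

End Length.

(** Lengths are compared along linear maps between the ambient modules that induce
    an isomorphism A / C -> A' / C'; inverse maps need not lift. *)
Section Isomorphism.
Variables (R : comNzRingType) (V V' : lmodType R) (phi : V -> V').
Variables (A C : set V) (A' C' : set V').
Hypotheses (lphi : linear phi) (sA : submodule A) (sC : submodule C).
Hypotheses (sA' : submodule A') (sC' : submodule C').
Hypotheses (CA : (C `<=` A)%classic) (CA' : (C' `<=` A')%classic).
Hypotheses (phiA : forall v, A v -> A' (phi v)).
Hypotheses (phiC : forall v, A v -> C' (phi v) <-> C v).
Hypotheses (phi_onto : forall v', A' v' -> exists2 v, A v & C' (v' - phi v)).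

Lemma chain_iso n : chain (sq_submodules (SubQuo A C)) n <->
  chain (sq_submodules (SubQuo A' C')) n.
Proof.
split=> -[D [SD ltD]].
  exists (fun i => image_plus phi (D i) C'); split=> i ik.
    have [s /= CD DA] := SD i ik; split=> /=.
    - exact: submodule_image_plus.
    - exact: image_plus_subr.
    - by move=> v [u /DA/phiA Au /CA' Avu]; apply: subBr Avu.
  have [s /= CD DA] := SD i (ltnW ik).
  have [s1 /= CD1 DA1] := SD i.+1 ik; have [D1 D2] := ltD i ik.
  split; first by move=> v [u Du Cu]; exists u => //; apply: D1.
  move=> sub; apply: D2 => v D1v.
  have [|u Du] := sub (phi v); first exact: mem_image_plus.
  rewrite -linB // => /phiC Cvu; apply: (@subBr _ _ _ _ u) => //.
  by apply: CD; apply: Cvu; apply: subB => //; [apply: DA1 | apply: DA].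
exists (fun i => A `&` phi @^-1` D i)%classic; split=> i ik.
  have [s /= CD DA] := SD i ik; split=> /=.
  - by apply: submoduleI => //; apply: submodule_preim.
  - by move=> v Cv; split; [exact: CA | apply: CD; apply/phiC => //; apply: CA].
  - by move=> v [].
have [s /= CD DA] := SD i (ltnW ik).
have [s1 /= CD1 DA1] := SD i.+1 ik; have [D1 D2] := ltD i ik.
split; first by move=> v [Av Dv]; split=> //; apply: D1.
move=> sub; apply: D2 => v' D1v'; have [v Av Cv] := phi_onto (DA1 _ D1v').
have [|_ Dv] := sub v; last by apply: subBr (CD _ Cv).
split=> //=; rewrite -[phi v](subKr v').
by apply: subB => //; apply: CD1.
Qed.

Lemma has_length_iso n : has_length A C n <-> has_length A' C' n.
Proof.
split=> -[ch mx]; (split; first by apply/chain_iso).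
  by move=> k /chain_iso; apply: mx.
by move=> k /chain_iso; apply: mx.
Qed.

Lemma has_length_image n : has_length A C n -> has_length A' C' n.
Proof. by move/has_length_iso. Qed.

Lemma has_length_preimage n : has_length A' C' n -> has_length A C n.
Proof. by move/has_length_iso. Qed.

End Isomorphism.

(** * Torsion and finite length over a Noetherian local ring *)

Section Torsion.
Variables (R : comNzRingType) (m : set R).
Local Open Scope classical_set_scope.

(** The elements v with m^k v in C, one factor at a time: in this form the
    elements killed by m^(s + t) modulo C are those that m^t sends to elements
    killed by m^s. *)
Definition killed (V : lmodType R) k (C : set V) : set V :=
  iter k (fun B => [set v | forall b, m b -> B (b *: v)]) C.

Definition torsion (V : lmodType R) (C : set V) : set V :=
  [set v | exists k, killed k C v].

Variable V : lmodType R.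
Implicit Types (A B C : set V) (u v w : V).

Lemma submodule_killed k C : submodule C -> submodule (killed k C).
Proof.
move=> sC; elim: k => //= k IH; apply/submoduleP; split=> [b _|a u v Bu Bv b mb].
  by rewrite scaler0; apply: sub0.
rewrite scalerDr scalerA mulrC -scalerA; apply: subD => //; last exact: Bv.
by apply: subZ => //; apply: Bu.
Qed.

Lemma killed_add k l C : killed k (killed l C) = killed (k + l) C.
Proof. by rewrite /killed iterD. Qed.

Lemma sub_killed k B C : B `<=` C -> killed k B `<=` killed k C.
Proof. by move=> BC; elim: k => //= k IH v Bv b /Bv/IH. Qed.

Lemma killed_sup k C : submodule C -> C `<=` killed k C.
Proof.
move=> sC; elim: k => //= k IH v Cv b _.
by apply: subZ; [exact: submodule_killed | exact: IH].
Qed.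

Lemma killed_leq k l C : submodule C -> (k <= l)%N -> killed k C `<=` killed l C.
Proof.
move=> sC kl; rewrite -(subnKC kl) -killed_add.
by apply: sub_killed; apply: killed_sup.
Qed.

Lemma submodule_torsion C : submodule C -> submodule (torsion C).
Proof.
move=> sC; apply/submoduleP; split; first by exists 0%N; apply: sub0.
move=> a u v [k ku] [l lv]; exists (maxn k l).
apply: subD; first exact: submodule_killed.
  apply: subZ; first exact: submodule_killed.
  by apply: killed_leq ku => //; apply: leq_maxl.
by apply: killed_leq lv => //; apply: leq_maxr.
Qed.

Lemma torsion_sup C : C `<=` torsion C.
Proof. by move=> v Cv; exists 0%N. Qed.

Lemma sub_torsion B C : B `<=` C -> torsion B `<=` torsion C.
Proof. by move=> BC v [k kv]; exists k; apply: sub_killed kv. Qed.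

Lemma torsion_killed k C D : D `<=` killed k C -> torsion D `<=` torsion C.
Proof.
move=> DC v [l lv]; exists (l + k)%N.
by rewrite -killed_add; apply: sub_killed lv.
Qed.

Lemma killed_scale k C a v :
  killed k C (a *: v) -> killed k [set u | C (a *: u)] v.
Proof.
elim: k v => //= k IH v kv b mb; apply: IH.
by rewrite scalerA mulrC -scalerA; apply: kv.
Qed.

Lemma torsion_scale C a v :
  torsion C (a *: v) -> torsion [set u | C (a *: u)] v.
Proof. by move=> [k kv]; exists k; apply: killed_scale. Qed.

Lemma torsion_mul C D a v : (forall u, C u -> D (a *: u)) ->
  torsion C v -> torsion D (a *: v).
Proof.
move=> CD [k kv]; exists k; elim: k v kv => [|k IH] v kv; first exact: CD.
by move=> b mb; rewrite scalerA mulrC -scalerA; apply: IH; apply: kv.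
Qed.

Lemma killed_pow k C v : submodule C ->
  killed k C v <-> forall a : R, pow_smul R^o m k a -> C (a *: v).
Proof.
move=> sC; elim: k v => [|k IH] v /=.
  by split=> [Cv a _|/(_ 1 I)]; [exact: subZ | rewrite scale1r].
split=> [kv a [n [b [w [mb kw ->]]]]|Cv b mb].
  rewrite scaler_suml; apply: sub_sum => // i _.
  rewrite -[b i *: _]/(b i * w i) mulrC -scalerA.
  by have /IH := kv _ (mb i); apply; apply: kw.
apply/IH => a ka; rewrite scalerA mulrC; apply: Cv.
by exists 1%N, (fun=> b), (fun=> a); split=> //; rewrite big_ord1.
Qed.

Lemma torsion_pow C : submodule C ->
  torsion C = [set v | exists k, forall a : R, pow_smul R^o m k a -> C (a *: v)].
Proof.
by move=> sC; apply/seteqP; split=> v [k kv]; exists k; apply/killed_pow.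
Qed.

End Torsion.

Section LocalRing.
Variables (R : comNzRingType) (m : set R).
Local Open Scope classical_set_scope.

Lemma proper_idealP (J : set R) :
  idealr_closed [in J] <-> submodule (J : set R^o) /\ ~ J 1.
Proof.
split=> [[J0 J1 JZ]|[/submoduleP[J0 JZ] J1]].
  split; last by move: J1; rewrite notin_setE.
  apply/submoduleP; split; first by rewrite inE in J0.
  by move=> a u v Ju Jv; have := JZ a u v; rewrite !inE; apply.
split; [by rewrite inE | by rewrite notin_setE|].
by move=> a u v; rewrite !inE; apply: JZ.
Qed.

Hypothesis R_local : local_ring m.

Let max_m : maximal_ideal m. Proof. exact/R_local. Qed.

Lemma submodule_m : submodule (m : set R^o).
Proof. by have [/proper_idealP[]] := max_m. Qed.

Variable V : lmodType R.
Implicit Types (A B C D L : set V) (u v w : V).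

Lemma submodule_colon_elt B v :
  submodule B -> submodule ([set c | B (c *: v)] : set R^o).
Proof.
move=> sB; apply/submoduleP; split=> /=; first by rewrite scale0r; apply: sub0.
move=> a b c Bb Bc /=; rewrite scalerDl; apply: subD => //.
by rewrite -[a *: b]/(a * b) -scalerA; apply: subZ.
Qed.

Lemma submodule_adjoin B v : submodule B ->
  submodule (image_plus (fun c : R^o => c *: v) setT B).
Proof.
move=> sB; apply: submodule_image_plus => // a b c.
by rewrite scalerDl -[a *: b]/(a * b) scalerA.
Qed.

(** A simple quotient A/B is killed by m, since the annihilator of a nonzero
    element of it is a maximal ideal. *)
Lemma simple_killed A B : submodule A -> submodule B -> B `<=` A ->
  (forall D, submodule D -> B `<=` D -> D `<=` A -> D = B \/ D = A) ->
  A `<=` killed m 1 B.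
Proof.
move=> sA sB BA simple v Av a ma /=.
have [Bv|nBv] := pselect (B v); first exact: subZ.
pose J : set R := [set c | B (c *: v)].
have sJ : submodule (J : set R^o) by apply: submodule_colon_elt.
suff /R_local eJ : maximal_ideal J by move: ma; rewrite -eJ.
split; first by apply/proper_idealP; split=> //; rewrite /J /= scale1r.
move=> K /proper_idealP[sK K1] JK; apply/seteqP; split=> // k Kk.
apply: contrapT => nJk; apply: K1.
pose D := image_plus (fun c : R^o => c *: v) K B.
have lin : linear (fun c : R^o => c *: v).
  by move=> x b c; rewrite scalerDl -[x *: b]/(x * b) scalerA.
have sD : submodule D by apply: submodule_image_plus.
case: (simple D sD) => [||eD|eD].
- exact: image_plus_subr.
- by move=> w [c _ /BA]; apply: subBr => //; apply: subZ.
- case: nJk; rewrite /J /= -eD; exact: (mem_image_plus (fun c : R^o => c *: v)).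
have [c Kc] : D v by rewrite eD.
rewrite -{1}[v]scale1r -scalerBl => Jc.
by apply: (@subBr _ _ (K : set R^o) _ c) => //; apply: JK.
Qed.

Lemma length1_simple A B D : has_length A B 1 -> submodule A -> submodule B ->
  B `<=` A -> submodule D -> B `<=` D -> D `<=` A -> D = B \/ D = A.
Proof.
move=> [_ mx] sA sB BA sD BD DA; have [|nDB] := pselect (D = B); first by left.
right; apply: contrapT => nDA; suff : (2 <= 1)%N by [].
apply: mx; exists (fun i => if i == 0%N then B else if i == 1%N then D else A).
split=> [[|[|[|i]]]|[|[|i]]] //= _; split=> // le.
- by apply: nDB; apply/seteqP.
- by apply: nDA; apply/seteqP.
Qed.

(** In a chain of maximal length consecutive members have simple quotients, each of
    which is killed by m. *)
Lemma finite_length_killed n A C : submodule A -> submodule C -> C `<=` A ->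
  has_length A C n -> A `<=` killed m n C.
Proof.
move=> + sC; elim: n A => [|n IH] A sA CA hn; first by rewrite (has_length0 sA sC CA hn).
have [[D [SD ltD]] mx] := hn.
have [/= sB CB BA] := SD n (leqnSn n); set B := D n in sB CB BA.
have [k hk] := has_length_sub sA sB sC CB BA hn.
have [l hl] := has_length_quo sA sB sC CB BA hn.
have kl : (l + k = n.+1)%N by apply: has_length_uniq hn; apply: has_lengthD hl hk.
have nk : (n <= k)%N.
  have [_ mxk] := hk; apply: mxk; exists D.
  split=> i lei; last exact/ltD/ltnW.
  have [s1 s2 s3] := SD i (leqW lei); split=> //=.
  have mono j : (i + j <= n)%N -> D i `<=` D (i + j)%N.
    elim: j => [|j IHj] lej; first by rewrite addn0.
    apply: (subset_trans (IHj _)); first by lia.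
    by rewrite addnS; have [] := ltD (i + j)%N ltac:(lia).
  by have := mono (n - i)%N; rewrite subnKC //; apply.
have l0 : l != 0%N.
  apply/eqP => l0; rewrite l0 in hl.
  have [D1 D2] := ltD n (ltnSn n); apply: D2.
  by have [_ _] := SD n.+1 (leqnn _); rewrite /= (has_length0 sA sB BA hl).
have [el ek] : l = 1%N /\ k = n by lia.
rewrite {}el {}ek in hl hk.
have := simple_killed sA sB BA (fun D => length1_simple hl sA sB BA).
move=> /subset_trans; apply; rewrite -add1n -killed_add.
by apply: sub_killed; apply: IH.
Qed.

End LocalRing.

Section Noetherian.
Variables (R : comNzRingType).
Local Open Scope classical_set_scope.

(** An impredicative span: inclusions are proved by testing generators. *)
Definition generated (V : lmodType R) (s : seq V) : set V :=
  [set v | forall E, submodule E -> (forall u, u \in s -> E u) -> E v].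

Lemma submodule_generated (V : lmodType R) (s : seq V) : submodule (generated s).
Proof.
apply/submoduleP; split=> [E sE _|a u v gu gv E sE Es]; first exact: sub0.
by apply: subD => //; [apply: subZ => //; apply: gu | apply: gv].
Qed.

Lemma mem_generated (V : lmodType R) (s : seq V) u : u \in s -> generated s u.
Proof. by move=> us E _; apply. Qed.

Lemma lspan_generated (V : lmodType R) (s : seq V) : lspan s = generated s.
Proof.
apply/seteqP; split=> v.
  move=> [a ->] E sE Es; apply: sub_sum => // i _.
  by apply: subZ => //; apply: Es; apply: mem_nth.
apply.
  apply/submoduleP; split.
    by exists (fun=> 0); rewrite big1 // => i _; rewrite scale0r.
  move=> a u w [b ->] [c ->]; exists (fun i => a * b i + c i).
  rewrite scaler_sumr -big_split /=; apply: eq_bigr => i _.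
  by rewrite scalerDl scalerA.
move=> u us; exists (fun i => (i == index u s)%:R).
have lt : (index u s < size s)%N by rewrite index_mem.
rewrite (bigD1 (Ordinal lt)) //= eqxx scale1r nth_index // big1 ?addr0 //.
move=> i /negPf; rewrite -val_eqE /= => ->; exact: scale0r.
Qed.

Hypothesis R_noetherian : noetherian R.

Lemma noetherian_ideal (J : set R^o) : submodule J -> exists t, J = generated t.
Proof. by move=> /R_noetherian[t ->]; exists t; rewrite lspan_generated. Qed.

(** Induction on the number of generators of an ambient module: the leading
    coefficients of the elements of D form an ideal, and lifts of its generators
    together with generators of the part of D without leading term generate D. *)
Lemma noetherian_submodule (V : lmodType R) (s : seq V) (D : set V) :
  submodule D -> D `<=` generated s -> exists t, D = generated t.
Proof.
elim: s D => [|e s IH] D sD Ds.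
  exists [::]; apply/seteqP; split=> v; first exact: Ds.
  by move=> gv; apply: (gv D).
pose lead (E : set V) : set R^o := [set a | exists2 d, E d & generated s (d - a *: e)].
have slead E : submodule E -> submodule (lead E).
  move=> sE; have sg := submodule_generated s.
  apply/submoduleP; split.
    by exists 0; [exact: sub0 | rewrite scale0r subr0; exact: sub0].
  move=> a b c [d Ed gd] [d' Ed' gd']; exists (a *: d + d').
    by apply: subD => //; apply: subZ.
  rewrite scalerDl opprD addrACA -[a *: b]/(a * b) -scalerA -scalerBr.
  by apply: (subD sg) => //; apply: (subZ _ sg).
have [a ea] := noetherian_ideal (slead D sD).
have [ds [dsD dsa]] : exists ds : seq V, (forall d, d \in ds -> D d) /\
    (forall c, c \in a -> exists2 d, d \in ds & generated s (d - c *: e)).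
  have : forall c, c \in a -> lead D c by move=> c /mem_generated; rewrite ea.
  elim: (a) => [|c l IHl] ld; first by exists [::].
  have [ds [dsD dsa]] := IHl (fun x xl => ld x (mem_behead (s := c :: l) xl)).
  have [d Dd gd] := ld c (mem_head _ _).
  exists (d :: ds); split=> x; rewrite inE => /predU1P[->|] //.
  - exact: dsD.
  - by exists d => //; apply: mem_head.
  - by move=> /dsa[d' d's gd']; exists d' => //; rewrite inE d's orbT.
have [t et] : exists t, D `&` generated s = generated t.
  apply: IH; last by move=> v [].
  by apply: submoduleI => //; apply: submodule_generated.
exists (ds ++ t); apply/seteqP; split=> v.
  move=> Dv E sE Edt.
  have Et : D `&` generated s `<=` E.
    by rewrite et => w; apply=> // u ut; apply: Edt; rewrite mem_cat ut orbT.
  have [c _ gvc] : image_plus (fun c : R^o => c *: e) setT (generated s) v.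
    apply: (Ds v Dv).
      apply: submodule_adjoin; exact: submodule_generated.
    move=> u; rewrite inE => /predU1P[->|us].
      by exists 1; rewrite // scale1r subrr; apply: sub0; apply: submodule_generated.
    by exists 0; rewrite // scale0r subr0; apply: mem_generated.
  have : lead D c by exists v.
  rewrite ea => /(_ (lead (D `&` E))) [||d [Dd Ed] gd].
  - by apply: slead; apply: submoduleI.
  - move=> b /dsa[d ds_d gd]; exists d => //; split; first exact: dsD.
    by apply: Edt; rewrite mem_cat ds_d.
  apply: (subBr sE Ed); apply: Et; split; first exact: subB.
  have -> : v - d = (v - c *: e) - (d - c *: e) by rewrite opprB addrA subrK.
  by apply: (subB (submodule_generated s)).
apply=> // u; rewrite mem_cat => /orP[/dsD//|/mem_generated].
by rewrite -et => -[].
Qed.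

Variables (m : set R).
Hypothesis (R_local : local_ring m).
Variable V : lmodType R.

(** Adding an element killed by a power of m to L produces a module of finite
    length over L: first add its multiples by generators of m, which are killed
    by a smaller power; over the result it spans a module killed by m. *)
Lemma adjoin_killed k (L : set V) v : submodule L -> killed m k L v ->
  exists B, [/\ submodule B, L `<=` B, B v & exists n, has_length B L n].
Proof.
elim: k L v => [|k IH] L v sL kv.
  by exists L; split=> //; exists 0%N; apply: has_length_refl.
have IHs (s : seq V) L' : submodule L' -> (forall u, u \in s -> killed m k L' u) ->
  exists B, [/\ submodule B, L' `<=` B, (forall u, u \in s -> B u) &
    exists n, has_length B L' n].
  elim: s L' => [|u s IHs] L' sL' ks.
    by exists L'; split=> //; exists 0%N; apply: has_length_refl.
  have [B1 [sB1 LB1 B1u [n1 h1]]] := IH L' u sL' (ks _ (mem_head _ _)).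
  have [|B2 [sB2 B12 B2s [n2 h2]]] := IHs B1 sB1.
    by move=> w ws; apply: sub_killed LB1 _ _; apply: ks; rewrite inE ws orbT.
  exists B2; split=> //; first exact: subset_trans B12.
    by move=> w; rewrite inE => /predU1P[->|/B2s//]; apply: B12.
  by exists (n2 + n1)%N; apply: has_lengthD h2 h1.
have [b eb] := noetherian_ideal (submodule_m R_local).
have [|B [sB LB Bb [n hn]]] := IHs [seq c *: v | c <- b] L sL.
  move=> u /mapP[c cb ->]; apply: kv.
  by rewrite eb; exact: (@mem_generated R^o b c).
have mB c : m c -> B (c *: v).
  suff : (m : set R^o) `<=` [set c | B (c *: v)] by apply.
  rewrite eb => x; apply; first exact: submodule_colon_elt.
  by move=> y yb; apply: Bb; apply: map_f.
pose D := image_plus (fun c : R^o => c *: v) setT B.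
have sD : submodule D by apply: submodule_adjoin.
have BD : B `<=` D.
  by move=> w Bw; exists 0 => //; rewrite scale0r subr0.
exists D; split=> //; first exact: subset_trans BD.
  by exists 1; rewrite // scale1r subrr; apply: sub0.
have [|l hl] := @has_length_le1 _ _ _ _ sD sB BD; last first.
  by exists (l + n)%N; apply: has_lengthD hl hn.
move=> E sE BE ED; have [|nEB] := pselect (E = B); first by left.
right; apply/seteqP; split=> // w [c _ Bwc].
apply: (@subBr _ _ _ _ (c *: v)) => //; last exact: BE.
apply: subZ => //; rewrite -[v]scale1r.
apply: contrapT => nE1; apply: nEB; apply/seteqP; split=> // {c Bwc}w Ew.
have [c _ Bwc] := ED w Ew.
suff mc : m c by apply: subBr (mB _ mc) Bwc.
have [_ mx] : maximal_ideal m by apply/R_local.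
have eK : [set a | E (a *: v)] = m.
  apply: mx; last by move=> x xm; apply: BE; apply: mB.
  by apply/proper_idealP; split=> //; apply: submodule_colon_elt.
rewrite -eK.
by rewrite /= -(subKr w (c *: v)); apply: subB => //; apply: BE.
Qed.

(** The torsion is finitely generated, so finitely many elements killed by powers
    of m have to be adjoined to L. *)
Lemma torsion_finite_length (L : set V) : finite_module V -> submodule L ->
  exists n, has_length (torsion m L) L n.
Proof.
move=> [s es] sL.
have [|t et] := noetherian_submodule (s := s) (submodule_torsion m sL).
  by rewrite -lspan_generated es.
have tT u : u \in t -> torsion m L u by move=> /mem_generated; rewrite et.
have [B [sB LB tB [n hn]]] : exists B, [/\ submodule B, L `<=` B,
    forall u, u \in t -> B u & exists n, has_length B L n].
  elim: (t) tT => [|u l IHl] lT.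
    by exists L; split=> //; exists 0%N; apply: has_length_refl.
  have [|B [sB LB lB [n hn]]] := IHl.
    by move=> w wl; apply: lT; rewrite inE wl orbT.
  have [k ku] := lT u (mem_head _ _).
  have [D [sD BD Du [n' hn']]] := adjoin_killed sB (sub_killed LB ku).
  exists D; split=> //; first exact: subset_trans BD.
    by move=> w; rewrite inE => /predU1P[->//|/lB]; apply: BD.
  by exists (n' + n)%N; apply: has_lengthD hn' hn.
have TB : torsion m L `<=` B by rewrite et => v; apply.
apply: has_length_sub sB (submodule_torsion m sL) sL _ TB hn.
exact: torsion_sup.
Qed.

End Noetherian.

(** * Sequences acting modulo a submodule *)

Section Generation.
Variables (R : comNzRingType) (V : lmodType R).
Implicit Types (s : seq R) (A C L W : set V) (u v w : V).
Local Open Scope classical_set_scope.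

(** (s) A + L, written so that gen (x :: s) A L is convertible to
    gen s A (x A + L): quotients by x are taken by enlarging L. *)
Definition gen s A L : set V :=
  foldl (fun B a => image_plus (fun v => a *: v) A B) L s.

(** I^k W + L for I = (s), when L is contained in W. *)
Definition filt s L W k : set V := iter k (fun A => gen s A L) W.

Lemma submodule_gen s A L : submodule A -> submodule L -> submodule (gen s A L).
Proof.
by move=> sA; elim: s L => //= a s IH L sL; apply: IH; apply: submodule_image_plus.
Qed.

(** The universal property of (s) A + L, through which inclusions are checked on
    generators. *)
Lemma gen_sub s A L C : submodule C -> L `<=` C ->
  (forall a u, a \in s -> A u -> C (a *: u)) -> gen s A L `<=` C.
Proof.
move=> sC; elim: s L => //= a s IH L LC sAC; apply: IH; last first.
  by move=> b u bs; apply: sAC; rewrite inE bs orbT.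
move=> v [u Au Lvu]; apply: subBr (LC _ Lvu) => //.
by apply: sAC => //; apply: mem_head.
Qed.

Lemma gen_cat s1 s2 A L : gen (s1 ++ s2) A L = gen s2 A (gen s1 A L).
Proof. exact: foldl_cat. Qed.

Lemma gen_sup s A L : submodule A -> L `<=` gen s A L.
Proof.
move=> sA; elim: s L => [|a s IH] L v //= Lv.
by apply: IH; apply: image_plus_subr Lv.
Qed.

Lemma gen_mul s A L a u :
  submodule A -> submodule L -> a \in s -> A u -> gen s A L (a *: u).
Proof.
move=> sA sL + Au; elim: s L sL => //= b s IH L sL; rewrite inE => /predU1P[->|aS].
  by apply: gen_sup => //; apply: (mem_image_plus (fun v => b *: v)).
by apply: IH => //; apply: submodule_image_plus.
Qed.

Lemma gen_mono s s' A A' L L' : submodule A' -> submodule L' ->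
  {subset s <= s'} -> A `<=` A' -> L `<=` L' -> gen s A L `<=` gen s' A' L'.
Proof.
move=> sA' sL' ss AA' LL'; apply: gen_sub; first exact: submodule_gen.
  by apply: subset_trans (gen_sup _ _).
by move=> a u /ss aS /AA' Au; apply: gen_mul.
Qed.

Lemma submodule_filt s L W k : submodule L -> submodule W -> submodule (filt s L W k).
Proof. by move=> sL sW; elim: k => //= k IH; apply: submodule_gen. Qed.

Lemma filt_sup s L W k : submodule L -> submodule W -> L `<=` W -> L `<=` filt s L W k.
Proof.
by move=> sL sW LW; case: k => //= k; apply: gen_sup; apply: submodule_filt.
Qed.

Lemma filt_mul s L W k a u : submodule L -> submodule W ->
  a \in s -> filt s L W k u -> filt s L W k.+1 (a *: u).
Proof. by move=> sL sW aS Fu; apply: gen_mul => //; apply: submodule_filt. Qed.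

Lemma filt_decr s L k : submodule L -> filt s L setT k.+1 `<=` filt s L setT k.
Proof. by move=> sL; elim: k => //= k IH; apply: gen_mono => //; apply: submodule_filt. Qed.

Lemma filt_mono s L W W' k : submodule L -> submodule W' -> W `<=` W' ->
  filt s L W k `<=` filt s L W' k.
Proof.
by move=> sL sW' WW'; elim: k => //= k IH; apply: gen_mono => //; apply: submodule_filt.
Qed.

Lemma filt_mono_base s L L' W k : submodule L' -> submodule W -> L `<=` L' ->
  filt s L W k `<=` filt s L' W k.
Proof.
by move=> sL' sW LL'; elim: k => //= k IH; apply: gen_mono => //; apply: submodule_filt.
Qed.

Lemma filt_le1 s L k : submodule L -> filt s L setT k.+1 `<=` gen s setT L.
Proof. by move=> sL /=; apply: gen_mono. Qed.

End Generation.

(** * d-sequences *)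

Section DSequences.
Variables (R : comNzRingType) (V : lmodType R).
Implicit Types (s : seq R) (A C L N W : set V) (u v w : V) (x y : R).
Local Open Scope classical_set_scope.

(** A d-sequence relative to V / L: the colon conditions modulo L itself involve the
    head x, and the others are the same conditions for s' on V / (x V + L). *)
Fixpoint dseq L s : Prop :=
  if s is x :: s' then
    (forall y v, y \in x :: s' -> L (x *: (y *: v)) -> L (y *: v)) /\
    dseq (gen [:: x] setT L) s'
  else True.

Lemma dseq_cat L s1 s2 : dseq L (s1 ++ s2) -> dseq (gen s1 setT L) s2.
Proof. by elim: s1 L => //= x s1 IH L [_] /IH. Qed.

(** The first members of s can be stripped off one at a time: if v = y u modulo
    L, then y (y u) is in L, hence so is y u. *)
Lemma dseq_socle L s v : submodule L -> dseq L s ->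
  (forall y, y \in s -> L (y *: v)) -> gen s setT L v -> L v.
Proof.
elim: s L => //= y s IH L sL [dy ds] sv gv.
have sL' : submodule (image_plus (fun v => y *: v) setT L).
  exact: submodule_image_plus.
have [|u _ Lvu] := IH _ sL' ds _ gv.
  move=> z zs; apply: image_plus_subr => //; apply: sv.
  by rewrite inE zs orbT.
have yh := mem_head y s; apply: (@subBr _ _ _ _ (y *: u)) => //.
apply: (dy _ _ yh); rewrite -[_ *: (_ *: _)](subKr (y *: v)).
by apply: subB => //; [exact: sv | rewrite -scalerBr; apply: subZ].
Qed.

(** A relation modulo N between multiples of members of s is one modulo L, since
    such multiples meet N inside L. *)
Lemma dseq_sup L N s : submodule L -> submodule N -> L `<=` N ->
  N `&` gen s setT L `<=` L -> dseq L s -> dseq N s.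
Proof.
elim: s L N => //= y s IH L N sL sN LN NgL [dy ds].
have sL' : submodule (image_plus (fun v => y *: v) setT L).
  exact: submodule_image_plus.
have gsub := @gen_sup _ _ s setT (image_plus (fun v => y *: v) setT L) (@submodule_setT _ _).
split.
  move=> z v zs Nyzv; apply: LN; apply: dy => //; apply: NgL; split=> //.
  by apply: gsub; apply: (mem_image_plus (fun v => y *: v)).
apply: IH ds => //; first exact: submodule_image_plus.
  by move=> v [u _ /LN Nvu]; exists u.
move=> v [[u _ Nvu] gv]; exists u => //; apply: NgL; split=> //.
apply: subB => //; first exact: submodule_gen.
by apply: gsub; apply: (mem_image_plus (fun v => y *: v)).
Qed.

(** Modulo L, with I = (s1, s2), elements of (s1)V in I^(k+1) V lie in (s1) I^k V.
    Moving the first member y of s2 to s1, write such an element as a + y b;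
    then y b is in (s1)V, so b is in (s1)V when k > 0, and b lies in (s1)I^(k-1)V
    by induction. *)
Lemma dseq_cap_filt L s1 s2 k : submodule L -> dseq L (s1 ++ s2) ->
  gen s1 setT L `&` filt (s1 ++ s2) L setT k.+1 `<=`
    gen s1 (filt (s1 ++ s2) L setT k) L.
Proof.
move=> sL; elim: s2 s1 k => [|y s2 IH] s1 k ds.
  by rewrite !cats0 => v [].
have eS : s1 ++ y :: s2 = rcons s1 y ++ s2 by rewrite cat_rcons.
have sg : submodule (gen s1 setT L) by apply: submodule_gen.
have ss1 : {subset s1 <= s1 ++ y :: s2} by move=> z zs; rewrite mem_cat zs.
have yS : y \in s1 ++ y :: s2 by rewrite mem_cat mem_head orbT.
set S := s1 ++ y :: s2 in eS ds ss1 yS *.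
elim: k => [|k IHk] v [gv Fv].
  exact: gv.
have sF j : submodule (filt S L setT j) by apply: submodule_filt.
have : gen (rcons s1 y) (filt S L setT k.+1) L v.
  rewrite eS; apply: IH; first by rewrite -eS.
  split; last by rewrite -eS.
  by rewrite -cats1 gen_cat; apply: gen_sup.
rewrite -cats1 gen_cat => -[b Fb gvb].
suff : gen s1 (filt S L setT k.+1) L (y *: b).
  by move=> gyb; apply: subBr gyb gvb; apply: submodule_gen.
have gyb : gen s1 setT L (y *: b).
  rewrite -(subKr v (y *: b)); apply: subB => //.
  by apply: (gen_mono _ sL _ _ _ gvb).
have gb : gen s1 setT L b.
  have /= [dy ds2] := dseq_cat ds.
  apply: (@dseq_socle _ (y :: s2)) => //.
    (* y cancels from y (z b), which is the multiple z (y b) of an element of (s1)V *)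
    move=> z zs; apply: (dy _ _ zs).
    by rewrite scalerA mulrC -scalerA; apply: subZ.
  by rewrite -gen_cat; apply: filt_le1 Fb.
have : gen s1 (filt S L setT k) L b by apply: IHk.
pose C := [set w | gen s1 (filt S L setT k.+1) L (y *: w)].
apply: (@gen_sub _ _ _ _ _ C).
- by apply: (submodule_preim (phi := fun w => y *: w)) => //; apply: submodule_gen.
- by move=> w Lw; apply: gen_sup => //; apply: subZ.
- move=> a u aS Fu; rewrite /C /= scalerA mulrC -scalerA.
  by apply: gen_mul => //; [exact: (sF k.+1) | exact: filt_mul].
Qed.

(** If x is regular on V / L then x u in I^(k+1) V lies in x I^k V, by the previous
    lemma for the initial segment x, and x can be cancelled. *)
Lemma dseq_filt_regular L x s k u : submodule L -> dseq L (x :: s) ->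
  (forall v, L (x *: v) -> L v) ->
  filt (x :: s) L setT k.+1 (x *: u) -> filt (x :: s) L setT k u.
Proof.
move=> sL ds reg Fxu.
have [|w Fw Lw] := @dseq_cap_filt L [:: x] s k sL ds (x *: u).
  by split=> //; apply: (mem_image_plus (fun v => x *: v)).
apply: subBr (Fw) _; first exact: submodule_filt.
apply: filt_sup => //; apply: reg; by rewrite scalerBr.
Qed.

End DSequences.

(** * The torsion of the associated graded module *)

Section GradedTorsion.
Variables (R : comNzRingType) (m : set R) (V : lmodType R).
Implicit Types (s : seq R) (A C L N W : set V) (u v w : V) (x y : R).
Local Open Scope classical_set_scope.

Definition filt_torsion s L k : set V := torsion m (filt s L setT k).

Definition gr_length s L k n : Prop :=
  has_length (filt s L setT k `&` filt_torsion s L k.+1) (filt s L setT k.+1) n.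

(** The torsion of gr_I(V/L) is generated in degree zero. *)
Definition torsion_generated s L : Prop := forall k,
  filt s L setT k `&` filt_torsion s L k.+1 `<=` filt s L (filt_torsion s L 1) k.

(** Elements generated by torsion of degree zero are torsion: the inclusion
    opposite to [torsion_generated]. *)
Lemma filt_torsion_mul s L k : submodule L ->
  filt s L (filt_torsion s L 1) k `<=` filt_torsion s L k.+1.
Proof.
move=> sL; elim: k => // k IH.
have sF j : submodule (filt s L setT j) by apply: submodule_filt.
apply: gen_sub => [|v Lv|a u aS /IH].
- exact: submodule_torsion.
- by apply: torsion_sup; apply: filt_sup.
- by apply: torsion_mul => w; apply: filt_mul.
Qed.

Section Quotients.
Variables (L : set V) (x : R) (s : seq R).
Hypotheses (sL : submodule L) (ds : dseq L (x :: s)).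

Let S := x :: s.

(** Over N = L : x the head x becomes regular, since x (x v) in L forces x v in L;
    the rest of the sequence is then studied over N' = x V + N. *)
Definition colon_head : set V := [set v | L (x *: v)].
Let N := colon_head.
Let N' := gen [:: x] setT N.

Lemma submodule_colon_head : submodule N.
Proof. exact: (submodule_preim (phi := fun v => x *: v)). Qed.
Let sN := submodule_colon_head.

Lemma submodule_quo_head : submodule N'.
Proof. exact: submodule_gen. Qed.
Let sN' := submodule_quo_head.

Lemma colon_head_sup : L `<=` N.
Proof. by move=> v Lv; apply: subZ. Qed.
Let LN := colon_head_sup.

Lemma colon_head_mul y v : y \in S -> N v -> L (y *: v).
Proof.
move=> yS Nv; case: ds => dx _; apply: dx => //.
by rewrite scalerA mulrC -scalerA; apply: subZ.
Qed.

(** All members of the sequence annihilate N modulo L, as the head does. *)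
Lemma colon_head_cap : N `&` gen S setT L `<=` L.
Proof.
move=> v [Nv gv]; apply: (@dseq_socle _ _ L S) => // y yS.
exact: colon_head_mul.
Qed.

Lemma colon_head_regular v : N (x *: v) -> N v.
Proof. by case: ds => dx _; apply: dx; apply: mem_head. Qed.

Lemma dseq_colon_head : dseq N S.
Proof. exact: dseq_sup colon_head_cap ds. Qed.

Lemma dseq_quo_head : dseq N' s.
Proof. by have [] := dseq_colon_head. Qed.

(** The filtrations modulo L, N and N' differ by N and by x V respectively,
    whatever the submodule W they start from. *)
Let filt_colonS W k : submodule W ->
  filt S N W k `<=` image_plus id (filt S L W k) N.
Proof.
move=> sW; elim: k => [|k IH] v.
  by move=> Wv; exists v; rewrite // subrr; apply: sub0.
have sF : submodule (filt S L W k) by apply: submodule_filt.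
have sF1 : submodule (filt S L W k.+1) by apply: submodule_filt.
apply: gen_sub => {v} [|v Nv|a u aS /IH[w Fw Nuw]].
- exact: submodule_image_plus.
- exact: image_plus_subr.
- exists (a *: w); first exact: filt_mul.
  by rewrite -scalerBr; apply: LN; apply: colon_head_mul.
Qed.

Let filt_quo W k : submodule W -> filt S N W k `<=` filt s N' W k.
Proof.
move=> sW; elim: k => // k IH.
have sF : submodule (filt s N' W k) by apply: submodule_filt.
apply: gen_sub => [|v Nv|a u aS /IH Fu].
- exact: submodule_gen.
- by apply: gen_sup => //; apply: image_plus_subr.
- move: aS; rewrite inE => /predU1P[->|aS]; last exact: filt_mul.
  by apply: gen_sup => //; apply: (mem_image_plus (fun v => x *: v)).
Qed.

Let filt_quoS W k : submodule W ->
  filt s N' W k `<=` image_plus (fun v => x *: v) setT (filt S N W k).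
Proof.
move=> sW; elim: k => [|k IH] v.
  by move=> Wv; exists 0; rewrite // scaler0 subr0.
have sF : submodule (filt S N W k) by apply: submodule_filt.
have sF1 : submodule (filt S N W k.+1) by apply: submodule_filt.
apply: gen_sub => {v} [|v [u _ Nvu]|a u aS /IH[w _ Fw]].
- exact: submodule_image_plus.
- by exists u => //; apply: gen_sup.
- exists (a *: w) => //; rewrite scalerA [x * a]mulrC -scalerA -scalerBr.
  by apply: filt_mul => //; rewrite inE aS orbT.
Qed.

Variable n0 : nat.
Hypothesis (N_killed : N `<=` killed m n0 L).

(** Being killed by a power of m, N does not affect torsion. *)
Lemma filt_torsion_colon k : filt_torsion S N k.+1 = filt_torsion S L k.+1.
Proof.
apply/seteqP; split; last first.
  by apply: sub_torsion; apply: filt_mono_base.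
have sF : submodule (filt S L setT k.+1) by apply: submodule_filt.
apply: (@torsion_killed _ _ _ n0) => v /filt_colonS[] // w Fw Nvw.
apply: (subBr (submodule_killed m n0 sF)) (_ : killed m n0 _ (v - w)).
  exact: killed_sup.
by apply: sub_killed (N_killed Nvw); apply: filt_sup.
Qed.

Let sW : submodule (filt_torsion S N 1).
Proof. by apply: submodule_torsion; apply: submodule_filt. Qed.

(** Modulo x, a torsion element is a combination g of torsion elements of degree
    zero. The rest is x u with u of lower degree, torsion because x is regular on
    the graded module, so that induction applies to u. *)
Lemma torsion_generated_regular :
  torsion_generated s N' -> torsion_generated S N.
Proof.
move=> tg; elim=> [|k IH] v [Fv Tv]; first exact: Tv.
have sG : submodule (filt S N (filt_torsion S N 1) k.+1) by apply: submodule_filt.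
have Gv : filt s N' (filt_torsion s N' 1) k.+1 v.
  apply: tg; split; first exact: filt_quo.
  by apply: sub_torsion Tv; apply: filt_quo.
have [//|u _ Gvu] := filt_quoS _ Gv.
have sF j : submodule (filt S N setT j) by apply: submodule_filt.
have Fxu : filt S N setT k.+1 (x *: u).
  rewrite -(subKr v (x *: u)); apply: subB => //.
  by apply: filt_mono Gvu.
have Txu : filt_torsion S N k.+2 (x *: u).
  rewrite -(subKr v (x *: u)); apply: subB => //; first exact: submodule_torsion.
  exact: filt_torsion_mul Gvu.
apply: subBr (Gvu) => //; apply: filt_mul => //; first exact: mem_head.
apply: IH; split; first exact: dseq_filt_regular dseq_colon_head colon_head_regular _.
apply: sub_torsion (torsion_scale Txu) => w.
exact: dseq_filt_regular dseq_colon_head colon_head_regular.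
Qed.

(** In positive degrees the graded modules of V / L and V / N coincide, since N
    meets I V + L inside L. *)
Lemma torsion_generated_colon : torsion_generated S N -> torsion_generated S L.
Proof.
move=> tg [|k] v [Fv Tv]; first exact: Tv.
have sT : submodule (filt_torsion S L 1).
  by apply: submodule_torsion; apply: submodule_filt.
have sF j : submodule (filt S L setT j) by apply: submodule_filt.
have [||g Gg Nvg] := @filt_colonS (filt_torsion S L 1) k.+1 _ v.
- exact: sT.
- rewrite -filt_torsion_colon; apply: tg; split.
    exact: filt_mono_base Fv.
  by apply: sub_torsion Tv; apply: filt_mono_base.
apply: subBr (Gg) _ => //; first exact: submodule_filt.
have sT1 : L `<=` filt_torsion S L 1.
  by apply: subset_trans (@torsion_sup _ m _ _); apply: filt_sup.
apply: filt_sup => //; apply: colon_head_cap; split=> //.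
apply: (@filt_le1 _ _ S L k) => //; apply: subB => //.
by apply: filt_mono Gg.
Qed.

Lemma gr_length_colonS k n : gr_length S N k.+1 n <-> gr_length S L k.+1 n.
Proof.
have sF j : submodule (filt S L setT j) by apply: submodule_filt.
have sFN j : submodule (filt S N setT j) by apply: submodule_filt.
have FFN j : filt S L setT j `<=` filt S N setT j by apply: filt_mono_base.
rewrite /gr_length filt_torsion_colon; apply: iff_sym.
have sT : submodule (filt_torsion S L k.+2) by apply: submodule_torsion.
apply: (@has_length_iso _ _ _ id) => //; try exact: submoduleI.
- by move=> v Fv; split; [exact: filt_decr | exact: torsion_sup].
- move=> v Fv; split; first exact: filt_decr.
  by rewrite -filt_torsion_colon; apply: torsion_sup.
- by move=> v [/FFN Fv Tv].
- move=> v [Fv _]; split=> [/filt_colonS[] // w Fw Nvw|]; last exact: FFN.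
  apply: subBr (Fw) _ => //; apply: filt_sup => //; apply: colon_head_cap; split=> //.
  by apply: (@filt_le1 _ _ S L k) => //; apply: subB => //; apply: filt_decr.
- move=> v [/filt_colonS[] // w Fw Nvw Tv]; exists w.
    split=> //; rewrite -(subKr v w); apply: subB => //.
    rewrite -filt_torsion_colon; apply: torsion_sup; exact: filt_sup.
  by apply: filt_sup.
Qed.

(** In degree zero V / (I V + L) is an extension of V / (I V + N) by N / L. *)
Lemma gr_length_colon0 l n :
  has_length N L l -> gr_length S N 0 n -> gr_length S L 0 (n + l).
Proof.
have sF j : submodule (filt S L setT j) by apply: submodule_filt.
have sFN j : submodule (filt S N setT j) by apply: submodule_filt.
have sT j : submodule (filt_torsion S L j) by apply: submodule_torsion.
move=> hl; rewrite /gr_length filt_torsion_colon => hn.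
apply: has_lengthD hn _ => //.
- exact: submoduleI.
- exact: filt_mono_base.
- move=> v Fv; split=> //.
  by rewrite -filt_torsion_colon; apply: torsion_sup.
apply: (has_length_image (phi := id)) hl => //.
- exact: filt_mono_base.
- exact: filt_sup.
- move=> v Nv; split=> [Fv|]; first by apply: colon_head_cap.
  exact: filt_sup.
- move=> v /filt_colonS[] // w Fw Nvw; exists (v - w) => //=.
  by rewrite subKr.
Qed.

(** Multiplication by x embeds gr(V/N), shifted by one degree, into itself with
    quotient gr(V/N'). On torsion the quotient map stays onto because the torsion
    of gr(V/N') is generated in degree zero, where the two modules agree. *)
Lemma gr_length_quoS k a b : torsion_generated s N' ->
  gr_length S N k a -> gr_length s N' k.+1 b -> gr_length S N k.+1 (b + a).
Proof.
move=> tg ha hb.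
have sF j : submodule (filt S N setT j) by apply: submodule_filt.
have sF' j : submodule (filt s N' setT j) by apply: submodule_filt.
have sT j : submodule (filt_torsion S N j) by apply: submodule_torsion.
have sT' j : submodule (filt_torsion s N' j) by apply: submodule_torsion.
set A := filt S N setT k.+1 `&` filt_torsion S N k.+2.
have sA : submodule A by apply: submoduleI.
have FF' j : filt S N setT j `<=` filt s N' setT j by apply: filt_quo.
have CA : filt S N setT k.+2 `<=` A.
  by move=> v Fv; split; [exact: filt_decr | exact: torsion_sup].
pose B := A `&` filt s N' setT k.+2.
have sB : submodule B by apply: submoduleI.
have CB : filt S N setT k.+2 `<=` B.
  by move=> v Fv; split; [exact: CA | exact: FF'].
apply: (has_lengthD (B := B)) => //; first by move=> v [].
  apply: (has_length_preimage (phi := id)) hb => //.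
  - exact: submoduleI.
  - by move=> v [].
  - by move=> v Fv; split; [exact: (filt_decr sN' Fv) | exact: torsion_sup].
  - by move=> v [/FF' Fv Tv]; split=> //; apply: sub_torsion Tv.
  - by move=> v Av; split=> [Fv|[]].
  move=> v /tg /filt_quoS[] // u _ Gvu; exists (v - x *: u).
    split; first by apply: filt_mono Gvu.
    exact: filt_torsion_mul.
  rewrite subKr; apply: filt_sup => //.
  by exists u; rewrite // subrr; apply: sub0.
apply: (has_length_image (phi := fun u => x *: u)) ha => //.
- exact: submoduleI.
- by move=> v Fv; split; [exact: filt_decr | exact: torsion_sup].
- move=> u [Fu Tu]; split; last first.
    apply: filt_sup => //; by exists u; rewrite // subrr; apply: sub0.
  split; first by apply: filt_mul => //; apply: mem_head.
  by apply: torsion_mul Tu => w; apply: filt_mul => //; apply: mem_head.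
- move=> u _; split=> [|Fu]; first exact: dseq_filt_regular dseq_colon_head colon_head_regular.
  by apply: filt_mul => //; apply: mem_head.
- move=> v [[Fv Tv] /filt_quoS[] // u _ Fvu]; exists u => //.
  have Fxu : filt S N setT k.+1 (x *: u).
    by rewrite -(subKr v (x *: u)); apply: subB => //; apply: filt_decr.
  have Txu : filt_torsion S N k.+2 (x *: u).
    by rewrite -(subKr v (x *: u)); apply: subB => //; apply: torsion_sup.
  split; first exact: dseq_filt_regular dseq_colon_head colon_head_regular _.
  apply: sub_torsion (torsion_scale Txu) => w.
  exact: dseq_filt_regular dseq_colon_head colon_head_regular.
Qed.
End Quotients.
End GradedTorsion.

(** * Modules of finite functions *)

Section FiniteFunctions.
Variables (R : comNzRingType) (V : lmodType R) (I : finType).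
Implicit Types (f g : {ffun I -> V}) (D : seq I) (N L : set V).
Local Open Scope classical_set_scope.

(** The functions with support in D and values in N: as a module, N^D. *)
Definition supported D N : set {ffun I -> V} :=
  [set f : {ffun I -> V} | forall i, if i \in D then N (f i) else f i = 0].

Lemma submodule_supported D N : submodule N -> submodule (supported D N).
Proof.
move=> sN; apply/submoduleP; split=> [i|a f g fD gD i].
  by rewrite ffunE; case: ifP => // _; apply: sub0.
rewrite !ffunE; have := fD i; have := gD i; case: ifP => _.
  by move=> Ng Nf; apply: subD => //; apply: subZ.
by move=> -> ->; rewrite scaler0 addr0.
Qed.

(** Split off one coordinate at a time, by evaluation at it. *)
Lemma has_length_supported D N L l : submodule N -> submodule L -> L `<=` N ->
  uniq D -> has_length N L l ->
  has_length (supported D N) (supported D L) (size D * l).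
Proof.
move=> sN sL LN + hl; elim: D => [_|i D IH /= /andP[iD /IH{}IH]].
  rewrite (_ : supported [::] L = supported [::] N) //.
  exact/has_length_refl/submodule_supported.
have LNs E : supported E L `<=` supported E N.
  by move=> f fL j; have := fL j; case: ifP => // _ /LN.
pose ev (f : {ffun I -> V}) := f i.
have lev : linear ev by move=> a f g; rewrite /ev !ffunE.
pose B := supported (i :: D) N `&` ev @^-1` L.
have sB : submodule B.
  by apply: submoduleI; [exact: submodule_supported | exact: submodule_preim].
have LB : supported (i :: D) L `<=` B.
  move=> f fL; split; first exact: LNs.
  by have := fL i; rewrite mem_head.
have sS E M : submodule M -> submodule (supported E M) by apply: submodule_supported.
rewrite mulSn; apply: (has_lengthD (B := B)) => //; try exact: sS; first by move=> f [].
  apply: (has_length_preimage (phi := ev)) hl => //; try exact: sS.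
  - by move=> f [].
  - by move=> f /(_ i); rewrite mem_head.
  - by move=> f fN; split=> [|[]].
  move=> v Nv; exists [ffun j => if j == i then v else 0].
    by move=> j; rewrite ffunE inE; case: eqP => //= _; case: ifP => // _; apply: sub0.
  by rewrite /ev ffunE eqxx subrr; apply: sub0.
apply: (has_length_image (phi := id)) IH => //; try exact: sS.
- move=> f fN; split=> [j|].
    have := fN j; rewrite inE; case: ifP => // jD; first by rewrite orbT.
    by move=> ->; case: ifP => // _; apply: sub0.
  by have := fN i; rewrite (negPf iD) /= /ev => ->; apply: sub0.
- move=> f fN; split=> fL j; have := fL j; have := fN j; rewrite inE.
    by case: ifP => //; rewrite orbT.
  case: ifP => [|_]; first by rewrite orbT.
  by move=> ->; case: ifP => // _ _; apply: sub0.
move=> f [fN fi]; exists [ffun j => if j == i then 0 else f j].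
  move=> j; have := fN j; rewrite ffunE inE.
  by case: eqP => [->|_] //=; rewrite (negPf iD).
move=> j; have := fN j; rewrite !ffunE inE; case: eqP => [-> _|_] /=.
  by rewrite subr0.
by rewrite subrr; case: ifP => // _ _; apply: sub0.
Qed.

End FiniteFunctions.

(** * The Koszul complex *)

Section KoszulDifferential.
Variables (R : comNzRingType) (V : lmodType R).
Local Open Scope classical_set_scope.

Lemma linear_koszul_d r (x : r.-tuple R) : linear (@koszul_d R V r x).
Proof.
move=> a f g; apply/ffunP => T; rewrite !ffunE scaler_sumr -big_split /=.
apply: eq_bigr => i _; rewrite !ffunE scalerDr !scalerA.
by congr (_ *: _ + _); rewrite mulrC.
Qed.

(** Subsets of {0, ..., r} are T+1 or {0} U (T+1) for T a subset of
    {0, ..., r-1}; accordingly K(x_0, x') = K(x') + K(x') e_0, and a chain f has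
    components [koszul_fst f] and [koszul_snd f]. *)
Definition shift r (T : {set 'I_r}) : {set 'I_r.+1} := [set lift ord0 i | i in T]%SET.

Definition koszul_fst r (f : koszul_space V r.+1) : koszul_space V r :=
  [ffun T => f (shift T)].
Definition koszul_snd r (f : koszul_space V r.+1) : koszul_space V r :=
  [ffun T => f (ord0 |: shift T)%SET].
Definition koszul_glue r (f g : koszul_space V r) : koszul_space V r.+1 :=
  [ffun S : {set 'I_r.+1} =>
     let T := (lift ord0 @^-1: S)%SET in if ord0 \in S then g T else f T].

Lemma mem_shift r (T : {set 'I_r}) i : (lift ord0 i \in shift T) = (i \in T).
Proof. by rewrite mem_imset //; apply: lift_inj. Qed.

Lemma ord0_shift r (T : {set 'I_r}) : (ord0 \in shift T) = false.
Proof. by apply/imsetP => -[i _ /eqP]; rewrite -val_eqE. Qed.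

Lemma card_shift r (T : {set 'I_r}) : #|shift T| = #|T|.
Proof. by rewrite card_imset //; apply: lift_inj. Qed.

Lemma card_shiftU r (T : {set 'I_r}) : #|(ord0 |: shift T)%SET| = #|T|.+1.
Proof. by rewrite cardsU1 ord0_shift card_shift. Qed.

Lemma shiftK r (T : {set 'I_r}) : (lift ord0 @^-1: shift T)%SET = T.
Proof. by apply/setP => i; rewrite inE mem_shift. Qed.

Lemma shiftUK r (T : {set 'I_r}) : (lift ord0 @^-1: (ord0 |: shift T))%SET = T.
Proof. by apply/setP => i; rewrite !inE mem_shift. Qed.

Lemma shift_ind r (P : {set 'I_r.+1} -> Prop) :
  (forall T : {set 'I_r}, P (shift T)) ->
  (forall T : {set 'I_r}, P (ord0 |: shift T)%SET) -> forall S, P S.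
Proof.
move=> P0 P1 S; pose T := (lift ord0 @^-1: S)%SET.
have eS : (S :\ ord0 = shift T)%SET.
  apply/setP => i; rewrite !inE; case: (unliftP ord0 i) => [j ->|->].
    by rewrite mem_shift inE.
  by rewrite ord0_shift eqxx.
have [S0|S0] := boolP (ord0 \in S).
  by rewrite -(finset.setD1K S0) eS.
suff -> : S = shift T by [].
by rewrite -eS; apply/esym/finset.setDidPl; rewrite disjoint_sym disjoints1.
Qed.

Lemma koszul_glueK1 r (f g : koszul_space V r) : koszul_fst (koszul_glue f g) = f.
Proof. by apply/ffunP => T; rewrite !ffunE ord0_shift shiftK. Qed.

Lemma koszul_glueK2 r (f g : koszul_space V r) : koszul_snd (koszul_glue f g) = g.
Proof. by apply/ffunP => T; rewrite !ffunE finset.setU11 shiftUK. Qed.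

Lemma linear_koszul_fst r : linear (@koszul_fst r).
Proof. by move=> a f g; apply/ffunP => T; rewrite !ffunE. Qed.

Lemma linear_koszul_snd r : linear (@koszul_snd r).
Proof. by move=> a f g; apply/ffunP => T; rewrite !ffunE. Qed.

Section Cons.
Variables (r : nat) (x0 : R) (x : r.-tuple R) (f : koszul_space V r.+1).

Lemma koszul_fst_d :
  koszul_fst (koszul_d [tuple of x0 :: x] f) =
  koszul_d x (koszul_fst f) + x0 *: koszul_snd f.
Proof.
apply/ffunP => T; rewrite !ffunE big_mkcond big_ord_recl ord0_shift /= addrC.
congr (_ + _); last first.
  rewrite (_ : #|_| = 0%N) ?expr0 ?mul1r ?tnth0 //.
  by apply: eq_card0 => j; rewrite !inE ltn0 andbF.
rewrite [RHS]big_mkcond; apply: eq_bigr => i _; rewrite mem_shift tnthS.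
case: ifP => // _; rewrite ffunE /shift finset.imsetU1; congr ((_ ^+ _ * _) *: _).
rewrite -(card_imset [pred j in T | (j < i)%N] (@lift_inj _ (@ord0 r))).
apply: eq_card => j; rewrite !inE.
case: (unliftP ord0 j) => [k ->|->].
  by rewrite mem_imset ?mem_imset ?inE //; apply: lift_inj.
rewrite ord0_shift; apply/esym/imsetP => -[k _ /eqP].
by rewrite -val_eqE.
Qed.

Lemma koszul_snd_d :
  koszul_snd (koszul_d [tuple of x0 :: x] f) = - koszul_d x (koszul_snd f).
Proof.
apply/ffunP => T; rewrite !ffunE big_mkcond big_ord_recl finset.setU11 /= add0r.
rewrite -sumrN [RHS]big_mkcond; apply: eq_bigr => i _.
rewrite !inE /= mem_shift tnthS; case: ifP => // _.
rewrite ffunE finset.setUCA -scaleNr -mulNr; congr ((_ * _) *: _); last first.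
  by rewrite /shift finset.imsetU1.
rewrite -[RHS]mulN1r -exprS; congr (_ ^+ _).
rewrite (cardD1 ord0) !inE eqxx /= add1n; congr _.+1.
rewrite -(card_imset [pred j in T | (j < i)%N] (@lift_inj _ (@ord0 r))).
apply: eq_card => j; rewrite !inE.
case: (unliftP ord0 j) => [k ->|->].
  by rewrite /= mem_imset ?mem_imset ?inE //; apply: lift_inj.
rewrite eqxx; apply/esym/imsetP => -[k _ /eqP].
by rewrite -val_eqE.
Qed.

End Cons.

Lemma koszul_space_eq r (f g : koszul_space V r.+1) :
  koszul_fst f = koszul_fst g -> koszul_snd f = koszul_snd g -> f = g.
Proof.
move=> e0 e1; apply/ffunP; apply: shift_ind => T.
  by have /ffunP/(_ T) := e0; rewrite !ffunE.
by have /ffunP/(_ T) := e1; rewrite !ffunE.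
Qed.

(** Induction on r: the decomposition K(x_0, x') = K(x') + K(x') e_0 replaces the
    cancellation of signs by that of two terms x_0 d'. *)
Lemma koszul_d_sqr r (x : r.-tuple R) (f : koszul_space V r) :
  koszul_d x (koszul_d x f) = 0.
Proof.
elim: r x f => [|r IH] x f.
  by apply/ffunP => T; rewrite !ffunE big_pred0 // => -[].
case/tupleP: x => x0 x; have ld := @linear_koszul_d r x.
apply: koszul_space_eq.
  rewrite koszul_fst_d koszul_snd_d koszul_fst_d (linD _ _ ld) IH (linZ _ _ ld) add0r.
  by rewrite scalerN subrr (lin0 (@linear_koszul_fst r)).
rewrite koszul_snd_d koszul_snd_d -[X in koszul_d x X]scaleN1r (linZ _ _ ld) IH scaler0 oppr0.
by rewrite (lin0 (@linear_koszul_snd r)).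
Qed.

End KoszulDifferential.

(** * Koszul homology modulo a submodule *)

Section RelativeKoszul.
Variables (R : comNzRingType) (V : lmodType R).
Implicit Types (L N : set V).
Local Open Scope classical_set_scope.

Definition koszul_vals r L : set (koszul_space V r) :=
  [set f : {ffun {set 'I_r} -> V} | forall T, L (f T)].

(** Cycles and boundaries of the Koszul complex of V / L, lifted to V. *)
Definition koszul_cyc r (x : r.-tuple R) L p : set (koszul_space V r) :=
  @koszul_chains R V r p `&` koszul_d x @^-1` koszul_vals L.
Definition koszul_bnd r (x : r.-tuple R) L p : set (koszul_space V r) :=
  @koszul_chains R V r p `&`
    image_plus (koszul_d x) (@koszul_chains R V r p.+1) (koszul_vals L).

Definition koszul_length r (x : r.-tuple R) L p n : Prop :=
  has_length (koszul_cyc x L p) (koszul_bnd x L p) n.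

Lemma submodule_koszul_chains r p : submodule (@koszul_chains R V r p).
Proof.
apply/submoduleP; split=> [S _|a f g fp gp S Sp]; first by rewrite ffunE.
by rewrite !ffunE fp // gp // scaler0 addr0.
Qed.

Lemma submodule_koszul_vals r L : submodule L -> submodule (koszul_vals (r := r) L).
Proof.
move=> sL; apply/submoduleP; split=> [T|a f g Lf Lg T]; first by rewrite ffunE; apply: sub0.
by rewrite !ffunE; apply: subD; rewrite //; apply: subZ.
Qed.

Hint Resolve submodule_koszul_chains submodule_koszul_vals linear_koszul_d : core.

Lemma submodule_koszul_cyc r (x : r.-tuple R) L p :
  submodule L -> submodule (koszul_cyc x L p).
Proof. by move=> sL; apply: submoduleI => //; apply: submodule_preim; auto. Qed.

Lemma submodule_koszul_bnd r (x : r.-tuple R) L p :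
  submodule L -> submodule (koszul_bnd x L p).
Proof. by move=> sL; apply: submoduleI => //; apply: submodule_image_plus; auto. Qed.

Lemma koszul_d_chains r (x : r.-tuple R) p (f : koszul_space V r) :
  koszul_chains p.+1 f -> koszul_chains p (koszul_d x f).
Proof.
move=> fp T Tp; rewrite ffunE big1 // => i iT.
by rewrite fp ?scaler0 // cardsU1 iT.
Qed.

Lemma koszul_d_vals r (x : r.-tuple R) L N (f : koszul_space V r) : submodule L ->
  (forall y v, y \in (x : seq R) -> N v -> L (y *: v)) ->
  koszul_vals N f -> koszul_vals L (koszul_d x f).
Proof.
move=> sL xN Nf T; rewrite ffunE; apply: sub_sum => // i _.
by rewrite -scalerA; apply: subZ => //; apply: xN => //; apply: mem_tnth.
Qed.

Lemma koszul_d_gen r (x : r.-tuple R) L (f : koszul_space V r) : submodule L ->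
  koszul_vals (gen x setT L) (koszul_d x f).
Proof.
move=> sL; apply: (@koszul_d_vals _ x _ setT) => // [|y v yx _].
  exact: submodule_gen.
exact: gen_mul.
Qed.

Lemma koszul_bnd_cyc r (x : r.-tuple R) L p : submodule L ->
  koszul_bnd x L p `<=` koszul_cyc x L p.
Proof.
move=> sL f [fp [g _ Lfg]]; split=> //=.
rewrite -[f](subrK (koszul_d x g)) (linD _ _ (@linear_koszul_d _ _ _ x)).
rewrite koszul_d_sqr addr0; apply: koszul_d_vals Lfg => // y v _.
exact: subZ.
Qed.

Lemma has_length_koszul_vals r p N L l : submodule N -> submodule L -> L `<=` N ->
  has_length N L l ->
  has_length (@koszul_chains R V r p `&` koszul_vals N)
             (@koszul_chains R V r p `&` koszul_vals L) ('C(r, p) * l).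
Proof.
move=> sN sL LN hl; pose D : {set {set 'I_r}} := [set S : {set 'I_r} | #|S| == p]%SET.
have eD (M : set V) : submodule M ->
    @koszul_chains R V r p `&` koszul_vals M = supported (enum D) M.
  move=> sM; apply/seteqP; split=> f.
    by move=> [fp fM] S; rewrite mem_enum inE; case: eqP => // /eqP /fp.
  move=> fM; split=> S; have := fM S; rewrite mem_enum inE; first by case: eqP.
  by case: eqP => // _ ->; apply: sub0.
rewrite !eD //; have -> : 'C(r, p) = size (enum D).
  by rewrite -cardE -[r in LHS]card_ord -card_draws.
by apply: has_length_supported => //; apply: enum_uniq.
Qed.

Lemma koszul_chains_cons r p (f : koszul_space V r.+1) :
  koszul_chains p.+1 f <->
  koszul_chains p.+1 (koszul_fst f) /\ koszul_chains p (koszul_snd f).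
Proof.
split=> [fp|[f0 f1]].
  by split=> T Tp; rewrite ffunE fp // ?card_shift // card_shiftU.
apply: shift_ind => T; rewrite ?card_shift ?card_shiftU => Tp.
  by have := f0 T Tp; rewrite ffunE.
by have := f1 T Tp; rewrite ffunE.
Qed.

Lemma koszul_vals_cons r L (f : koszul_space V r.+1) :
  koszul_vals L f <-> koszul_vals L (koszul_fst f) /\ koszul_vals L (koszul_snd f).
Proof.
split=> [fL|[f0 f1]]; first by split=> T; rewrite ffunE.
apply: shift_ind => T; first by have := f0 T; rewrite ffunE.
by have := f1 T; rewrite ffunE.
Qed.

Section Recursion.
Variables (L : set V) (x0 : R) (r : nat) (x : r.-tuple R).
Hypotheses (sL : submodule L) (ds : dseq L (x0 :: x)).

Let S := x0 :: x.
Let xs : r.+1.-tuple R := [tuple of x0 :: x].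
Let N := colon_head L x0.
Let N' := gen [:: x0] setT N.
Let sN : submodule N := submodule_colon_head x0 sL.
Let sN' : submodule N' := submodule_quo_head x0 sL.
Let LN : L `<=` N := colon_head_sup x0 sL.
Let NgL := colon_head_cap sL ds.
Let xN y v : y \in (x : seq R) -> N v -> L (y *: v).
Proof. by move=> yx; apply: (colon_head_mul sL ds); rewrite inE yx orbT. Qed.

(** The multipliers of x0 can be chosen to form a chain of the same degree. *)
Let vals_quo p (f : koszul_space V r) : koszul_chains p f -> koszul_vals N' f ->
  exists2 u, koszul_chains p u & koszul_vals N (f - x0 *: u).
Proof.
move=> fp fN.
have [c cN] := choice (fun T => let: ex_intro2 u _ Nu := fN T in
   ex_intro (fun u => N (f T - x0 *: u)) u Nu).
exists [ffun T : {set 'I_r} => if #|T| == p then c T else 0].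
  by move=> T Tp; rewrite ffunE (negPf Tp).
move=> T; rewrite !ffunE; case: eqP => [_|/eqP Tp]; first exact: cN.
by rewrite (fp T Tp) scaler0 subr0; apply: sub0.
Qed.

(** Boundaries have values in I V + L, which meets N inside L. *)
Lemma koszul_bnd_colon p : koszul_bnd xs L p `&` koszul_vals N =
  @koszul_chains R V r.+1 p `&` koszul_vals L.
Proof.
apply/seteqP; split=> [f [[fp [g gp Lfg]] Nf]|f [fp fL]].
  split=> // T; apply: NgL; split; first exact: Nf.
  rewrite -[f](subrK (koszul_d xs g)) ffunE; apply: subD; first exact: submodule_gen.
    by apply: gen_sup => //; apply: Lfg.
  exact: (koszul_d_gen xs g sL).
split; last by move=> T; apply: LN.
split=> //; exists 0; first exact: sub0.
by rewrite (lin0 (@linear_koszul_d _ _ _ xs)) subr0.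
Qed.

Let koszul_vals_fst (f : koszul_space V r.+1) M :
  koszul_vals M f -> koszul_vals M (koszul_fst f).
Proof. by case/koszul_vals_cons. Qed.

Let d_fst (f : koszul_space V r.+1) :
  koszul_d x (koszul_fst f) = koszul_fst (koszul_d xs f) - x0 *: koszul_snd f.
Proof. by rewrite koszul_fst_d addrK. Qed.

(** The first component of the boundary is x0 times the second component of f, up
    to d of the first component of f, which has values in L. *)
Let vals_colon (f : koszul_space V r.+1) : koszul_vals N (koszul_fst f) ->
  koszul_vals L (koszul_d xs f) -> koszul_vals N f.
Proof.
move=> f0 /koszul_vals_fst dL; apply/koszul_vals_cons; split=> // T.
suff /(_ T) : koszul_vals L (x0 *: koszul_snd f) by rewrite ffunE.
have -> : x0 *: koszul_snd f = koszul_fst (koszul_d xs f) - koszul_d x (koszul_fst f).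
  by rewrite koszul_fst_d addrAC subrr add0r.
apply: (subB (submodule_koszul_vals _ sL)) => //.
exact: koszul_d_vals f0.
Qed.

(** The projection K(x0, x; V/L) -> K(x; V/N') identifies the homology of the
    second complex with the quotient of the homology of the first by the classes
    of the chains with values in N. A cycle f' of the second complex satisfies
    d f' = x0 u modulo N and lifts to f' - u e_0: its boundary has values both in N
    and in I V + L, hence in L. If f projects to a boundary d g' + x0 u, then f
    minus the boundary of g' + u e_0 has values in N. *)
Lemma koszul_length_fst p n : koszul_length x N' p.+1 n <->
  has_length (koszul_cyc xs L p.+1)
    (image_plus id (koszul_bnd xs L p.+1)
       (@koszul_chains R V r.+1 p.+1 `&` koszul_vals N)) n.
Proof.
have sb := submodule_koszul_bnd xs p.+1 sL.
have sc := submodule_koszul_cyc xs p.+1 sL.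
have sk : submodule (@koszul_chains R V r.+1 p.+1 `&` koszul_vals N).
  by apply: submoduleI; auto.
have lf := @linear_koszul_fst R V r; have ld := @linear_koszul_d R V r x.
have ldx := @linear_koszul_d R V r.+1 xs.
have quoN (f u : koszul_space V r) : koszul_vals N (f - x0 *: u) -> koszul_vals N' f.
  by move=> Nf T; exists (u T) => //; have := Nf T; rewrite !ffunE.
apply: iff_sym; apply: (has_length_iso (phi := @koszul_fst R V r)) => //.
- exact: submodule_koszul_cyc.
- exact: submodule_koszul_bnd.
- move=> f [b /(koszul_bnd_cyc sL) bc [fbp Nfb]]; apply: (subBr sc bc); split=> //=.
  by apply: koszul_d_vals Nfb => // y v; apply: (colon_head_mul sL ds).
- exact: koszul_bnd_cyc.
- move=> f [/koszul_chains_cons[fp _] /= dL]; split=> //=.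
  apply: (quoN _ (- koszul_snd f)); rewrite d_fst scalerN opprK subrK => T.
  by apply: LN; apply: koszul_vals_fst dL T.
- move=> f [fp dL]; split; last first.
    move=> [b [bp [g gp Lbg]] [_ Nfb]]; split; first by case/koszul_chains_cons: fp.
    exists (koszul_fst g); first by case/koszul_chains_cons: gp.
    apply: (quoN _ (koszul_snd g)).
    have -> : koszul_fst f - koszul_d x (koszul_fst g) - x0 *: koszul_snd g =
        koszul_fst (f - b) + koszul_fst (b - koszul_d xs g).
      by rewrite !(linB _ _ lf) koszul_fst_d addrA subrK opprD addrA.
    apply: (subD (submodule_koszul_vals _ sN)); first exact: koszul_vals_fst.
    by move=> T; apply: LN; apply: koszul_vals_fst Lbg T.
  move=> [f0p [g' g'p N'fg]].
  have [|u up Nu] := @vals_quo p.+1 _ _ N'fg.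
    by apply: (subB (submodule_koszul_chains _ _)) => //; apply: koszul_d_chains.
  pose g := koszul_glue g' u.
  have gp : koszul_chains p.+2 g.
    by apply/koszul_chains_cons; rewrite koszul_glueK1 koszul_glueK2.
  have dgp : koszul_chains p.+1 (koszul_d xs g) by apply: koszul_d_chains.
  exists (koszul_d xs g).
    split=> //; exists g; rewrite // subrr; exact: (sub0 (submodule_koszul_vals _ sL)).
  split; first exact: (subB (submodule_koszul_chains _ _)).
  apply: vals_colon.
    rewrite (linB _ _ lf) koszul_fst_d koszul_glueK1 koszul_glueK2.
    by rewrite opprD addrA.
  by rewrite (linB _ _ ldx) koszul_d_sqr subr0.
- move=> f' [f'p dN'].
  have [u up Nu] := vals_quo (koszul_d_chains x f'p) dN'.
  pose f := koszul_glue f' (- u).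
  have ef : koszul_fst f = f' by rewrite koszul_glueK1.
  have eu : koszul_snd f = - u by rewrite koszul_glueK2.
  exists f; last by rewrite ef subrr; exact: (sub0 (submodule_koszul_bnd _ _ sN')).
  have fp : koszul_chains p.+1 f.
    apply/koszul_chains_cons; rewrite ef eu; split=> //.
    exact: (subN (submodule_koszul_chains _ _)).
  have cap (g : koszul_space V r) : koszul_vals N g -> koszul_vals (gen S setT L) g ->
    koszul_vals L g by move=> Ng Gg T; apply: NgL; split; [exact: Ng | exact: Gg].
  have dG (g : koszul_space V r) : koszul_vals (gen S setT L) (koszul_d x g).
    move=> T; apply: gen_mono (@koszul_d_gen _ x L g sL T) => // y yx.
    by rewrite inE yx orbT.
  split=> //=; apply/koszul_vals_cons; split.
    rewrite koszul_fst_d ef eu scalerN; apply: cap => // T.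
    rewrite ffunE; apply: subD; [exact: submodule_gen | exact: dG |].
    by rewrite !ffunE; apply: subN; [exact: submodule_gen |
       apply: gen_mul => //; apply: mem_head].
  rewrite koszul_snd_d eu -[- u]scaleN1r (linZ _ _ ld) scaleN1r opprK.
  apply: cap => //.
  have Nx (g : koszul_space V r) : koszul_vals L (x0 *: g) -> koszul_vals N g.
    by move=> Lg T; have := Lg T; rewrite ffunE.
  apply: Nx.
  have -> : x0 *: koszul_d x u = - koszul_d x (koszul_d x f' - x0 *: u).
    by rewrite (linB _ _ ld) koszul_d_sqr (linZ _ _ ld) sub0r opprK.
  apply: (subN (submodule_koszul_vals _ sL)).
  exact: koszul_d_vals Nu.
Qed.

(** The chains with values in N, whose classes make up the kernel of the projection
    on homology. *)
Let kN p := @koszul_chains R V r.+1 p `&` koszul_vals N.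
Let kL p := @koszul_chains R V r.+1 p `&` koszul_vals L.
Let skN p : submodule (kN p).
Proof. by apply: submoduleI; auto. Qed.
Let skL p : submodule (kL p).
Proof. by apply: submoduleI; auto. Qed.
Let kLN p : kL p `<=` kN p.
Proof. by move=> f [fp fL]; split=> // T; apply: LN. Qed.

Let sb p : submodule (koszul_bnd xs L p). Proof. exact: submodule_koszul_bnd. Qed.
Let sc p : submodule (koszul_cyc xs L p). Proof. exact: submodule_koszul_cyc. Qed.

Let bndN p := image_plus id (koszul_bnd xs L p) (kN p).
Let sbN p : submodule (bndN p). Proof. exact: submodule_image_plus. Qed.
Let bnd_bndN p : koszul_bnd xs L p `<=` bndN p.
Proof. by move=> f fb; exists f; rewrite // subrr; apply: sub0. Qed.
Let kN_cyc p : kN p `<=` koszul_cyc xs L p.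
Proof.
move=> f [fp Nf]; split=> //=; apply: koszul_d_vals Nf => // y v.
exact: (colon_head_mul sL ds).
Qed.
Let bndN_cyc p : bndN p `<=` koszul_cyc xs L p.
Proof.
move=> f [b /(koszul_bnd_cyc sL) bb /kN_cyc Nfb].
exact: subBr bb Nfb.
Qed.

Let koszul_length_bndN p n :
  has_length (kN p) (kL p) n <-> has_length (bndN p) (koszul_bnd xs L p) n.
Proof.
apply: (has_length_iso (phi := id)) => //.
- by move=> f Nf; apply: image_plus_subr.
- move=> f Nf; split=> [fb|Lf].
    by rewrite /kL -koszul_bnd_colon; split=> //; case: Nf.
  by have : kL p f by []; rewrite /kL -koszul_bnd_colon => -[].
- by move=> f [b bb Nfb]; exists (f - b); rewrite //= subKr.
Qed.

Lemma koszul_length_cons p l n : has_length N L l -> koszul_length x N' p.+1 n ->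
  koszul_length xs L p.+1 (n + 'C(r.+1, p.+1) * l).
Proof.
move=> hl /koszul_length_fst hn; apply: (has_lengthD (B := bndN p.+1)) => //.
by apply/koszul_length_bndN; apply: has_length_koszul_vals.
Qed.

Lemma koszul_length_quo_exists p n : koszul_length xs L p.+1 n ->
  exists k, koszul_length x N' p.+1 k.
Proof.
move=> hn; have [k hk] := has_length_quo (sc _) (sbN _) (sb _) (@bnd_bndN _) (@bndN_cyc _) hn.
by exists k; apply/koszul_length_fst.
Qed.

(** V / L has the submodule N / L in its top Koszul homology. *)
Lemma koszul_length_colon_exists n : koszul_length xs L r.+1 n ->
  exists l, has_length N L l.
Proof.
move=> hn; have [l hl] := has_length_sub (sc _) (sbN _) (sb _) (@bnd_bndN _) (@bndN_cyc _) hn.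
exists l; move/koszul_length_bndN: hl.
have top (T : {set 'I_r.+1}) : #|T| = r.+1 -> T = [set: 'I_r.+1]%SET.
  move=> cT; apply/eqP; rewrite eqEcard finset.subsetT cardsT card_ord cT.
  exact: leqnn.
apply: (has_length_image (phi := fun f : koszul_space V r.+1 => f [set: 'I_r.+1]%SET)) => //.
- by move=> a f g; rewrite !ffunE.
- by move=> f [_ Nf]; apply: Nf.
- move=> f [fp Nf]; split=> [Lf|[_ Lf]]; last exact: Lf.
  split=> // T; have [/top ->//|nT] := @eqP _ #|T| r.+1.
  by rewrite fp; [exact: sub0 | apply/eqP].
move=> v Nv; exists [ffun T => if T == [set: 'I_r.+1]%SET then v else 0].
  split=> T; rewrite ffunE; case: (T =P _) => [eT|_] //; last exact: sub0.
  by rewrite eT cardsT card_ord eqxx.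
by rewrite ffunE eqxx subrr; apply: sub0.
Qed.

End Recursion.

Lemma koszul_length_nil p L : submodule L -> koszul_length [tuple] L p.+1 0.
Proof.
move=> sL; rewrite /koszul_length (_ : koszul_bnd _ _ _ = koszul_cyc [tuple] L p.+1).
  exact/has_length_refl/submodule_koszul_cyc.
have f0 (f : koszul_space V 0) : koszul_chains p.+1 f -> f = 0.
  move=> fp; apply/ffunP => T; rewrite fp ?ffunE //.
  by rewrite neq_ltn ltnS (leq_trans (max_card _)) // card_ord.
apply/seteqP; split; first exact: koszul_bnd_cyc.
move=> f [/f0 -> _]; exact: (sub0 (submodule_koszul_bnd _ _ sL)).
Qed.

End RelativeKoszul.

(** * Power series with denominator a power of 1 - t *)

Section Series.
Implicit Types (u v : nat -> int) (p q : {poly int}).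

(** The effect on u of multiplying its generating series by 1 - t. *)
Definition diff u (n : nat) : int := u n - (if n is k.+1 then u k else 0).

Lemma is_series_diff u p r :
  is_series_of u p ((1 - 'X) ^+ r.+1) <-> is_series_of (diff u) p ((1 - 'X) ^+ r).
Proof.
suff e q n : \sum_(i < n.+1) u i * (q * (1 - 'X))`_(n - i) =
    \sum_(i < n.+1) diff u i * q`_(n - i).
  by rewrite exprSr; split=> H n; [rewrite -e | rewrite e].
have eq : (fun k => (q * (1 - 'X))`_k) =1 (fun k => q`_k - (if k is l.+1 then q`_l else 0)).
  by move=> [|k]; rewrite mulrBr mulr1 coefB coefMX.
under eq_bigr do rewrite eq mulrBr.
under [RHS]eq_bigr do rewrite mulrBl.
rewrite !sumrB; congr (_ - _).
rewrite big_ord_recr /= subnn mulr0 addr0 big_ord_recl mul0r add0r.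
apply: eq_bigr => i _; rewrite lift0.
by have -> : (n - i = (n - i.+1).+1)%N by have := ltn_ord i; lia.
Qed.

Lemma is_series0 u p : is_series_of u p 1 <-> u =1 (fun n => p`_n).
Proof.
suff e n : \sum_(i < n.+1) u i * (1 : {poly int})`_(n - i) = u n.
  by split=> H n; [rewrite -H e | rewrite e].
rewrite big_ord_recr /= subnn coef1 mulr1 big1 ?add0r // => i _.
by rewrite coef1 subn_eq0 leqNgt ltn_ord mulr0.
Qed.

Lemma is_series_uniq u v p r : is_series_of u p ((1 - 'X) ^+ r) ->
  is_series_of v p ((1 - 'X) ^+ r) -> u =1 v.
Proof.
elim: r u v => [|r IH] u v.
  by rewrite expr0 => /is_series0 eu /is_series0 ev n; rewrite eu ev.
move=> /is_series_diff hu /is_series_diff hv.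
have e := IH _ _ hu hv.
by elim=> [|n IHn]; have := e _; [move=> /(_ 0%N)|move=> /(_ n.+1)];
  rewrite /diff ?subr0 // IHn => /addIr.
Qed.

Lemma is_series_num u p p' q : is_series_of u p q -> is_series_of u p' q -> p = p'.
Proof. by move=> hp hp'; apply/polyP => n; rewrite -hp -hp'. Qed.

Lemma is_series_ext u v p q : u =1 v -> is_series_of u p q -> is_series_of v p q.
Proof. by move=> e H n; rewrite -H; apply: eq_bigr => i _; rewrite e. Qed.

Lemma is_series_sum (I : finType) (c : I -> int) (u : I -> nat -> int)
    (p : I -> {poly int}) q : (forall i, is_series_of (u i) (p i) q) ->
  is_series_of (fun n => \sum_i c i * u i n) (\sum_i c i *: p i) q.
Proof.
move=> H n; rewrite coef_sum; under eq_bigr do rewrite mulr_suml.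
rewrite exchange_big; apply: eq_bigr => i _.
by rewrite coefZ -H mulr_sumr; apply: eq_bigr => k _; rewrite mulrA.
Qed.

Lemma is_seriesD u v p p' q : is_series_of u p q -> is_series_of v p' q ->
  is_series_of (fun n => u n + v n) (p + p') q.
Proof.
move=> hu hv n; rewrite coefD -hu -hv -big_split /=.
by apply: eq_bigr => i _; rewrite mulrDl.
Qed.

Lemma is_series_const (c : int) q :
  is_series_of (fun n => if n == 0%N then c else 0) (c *: q) q.
Proof.
move=> n; rewrite big_ord_recl /= subn0 big1 ?addr0 ?coefZ // => i _.
by rewrite mul0r.
Qed.

(** Pascal's rule: C(n + s, s) generates 1 / (1 - t)^(s + 1). *)
Lemma is_series_bin s t :
  is_series_of (fun n => 'C(n + s, s)%:Z) ((1 - 'X) ^+ t) ((1 - 'X) ^+ (s + t).+1).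
Proof.
elim: s => [|s IH]; apply/is_series_diff.
  apply: (@is_series_ext (fun n => if n == 0%N then 1 else 0)).
    by case=> [|n]; rewrite /diff !bin0 ?subr0 ?subrr.
  by rewrite -[X in is_series_of _ X _]scale1r; apply: is_series_const.
apply: is_series_ext IH => -[|n]; rewrite /diff.
  by rewrite add0n !binn subr0.
by rewrite [(n.+1 + s.+1)%N]addSn binS PoszD addrAC subrr add0r addSnnS.
Qed.

End Series.

(** * Binomial expansions *)

Section Expansions.
Variable r : nat.
Implicit Types (c : 'I_r.+1 -> int) (h : nat -> int).

(** The sequence Sum_i (-1)^i c_i C(n + r - i, r - i) has generating series
    Sum_i (-1)^i c_i (1 - t)^i / (1 - t)^(r + 1). *)
Definition expansion_num c : {poly int} :=
  \sum_(i < r.+1) ((-1) ^+ i * c i) *: (1 - 'X) ^+ i.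

Lemma is_series_expansion c :
  is_series_of (fun n => \sum_(i < r.+1) ((-1) ^+ i * c i) * 'C(n + (r - i), r - i)%:Z)
    (expansion_num c) ((1 - 'X) ^+ r.+1).
Proof.
apply: is_series_sum => i; have := is_series_bin (r - i) i.
by rewrite subnK // -ltnS.
Qed.

(** Substituting 1 - t for t turns the expansion into one in powers of t. *)
Lemma expansion_num_inj c c' : expansion_num c = expansion_num c' -> c =1 c'.
Proof.
have e d : expansion_num d \Po (1 - 'X) = \sum_(i < r.+1) ((-1) ^+ i * d i) *: 'X^i.
  rewrite /expansion_num raddf_sum /=; apply: eq_bigr => i _.
  rewrite comp_polyZ rmorphXn /= rmorphB /= comp_polyX comp_polyC.
  by rewrite opprB addrC subrK.
have co d (i : 'I_r.+1) : (expansion_num d \Po (1 - 'X))`_i = (-1) ^+ i * d i.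
  rewrite e coef_sum (bigD1 i) //= coefZ coefXn eqxx mulr1 big1 ?addr0 // => j ji.
  by rewrite coefZ coefXn eq_sym (inj_eq val_inj) (negPf ji) mulr0.
move=> ee i; have := co c i; rewrite ee co.
by move/(congr1 ( *%R ((-1) ^+ i))); rewrite !mulrA -exprMn mulrNN mulr1 expr1n !mul1r.
Qed.

Definition koszul_num h : {poly int} := \sum_(i < r.+1) ((-1) ^+ i * h i) *: 'X^i.

Definition expansion_coef h (i : nat) : int :=
  \sum_(i <= k < r.+1) (-1) ^+ k * h k * ('C(k, i))%:Z.

Lemma expansion_coefE h i :
  expansion_coef h i = \sum_(k < r.+1) (-1) ^+ k * h k * ('C(k, i))%:Z.
Proof.
rewrite /expansion_coef big_geq_mkord big_mkcond; apply: eq_bigr => k _ /=.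
by case: leqP => // ki; rewrite bin_small // mulr0.
Qed.

(** Expand each t^k = (1 - (1 - t))^k in powers of 1 - t. *)
Lemma koszul_num_expansion h : koszul_num h = expansion_num (fun i => expansion_coef h i).
Proof.
rewrite /expansion_num; under [RHS]eq_bigr do
  rewrite expansion_coefE mulr_sumr scaler_suml.
rewrite exchange_big; apply: eq_bigr => k _ /=.
have -> : 'X^k = \sum_(i < k.+1) ((-1) ^+ i * ('C(k, i))%:Z) *: (1 - 'X) ^+ i :> {poly int}.
  rewrite -[X in X ^+ k](subKr 1) exprBn; apply: eq_bigr => i _.
  rewrite expr1n mulr1 -scalerA -scaler_nat natz -!mul_polyC rmorphXn rmorphN1.
  by rewrite mulrCA.
rewrite scaler_sumr.
rewrite (big_ord_widen r.+1 (fun i => ((-1) ^+ k * h k) *: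
  (((-1) ^+ i * ('C(k, i))%:Z) *: (1 - 'X) ^+ i : {poly int}))) //.
rewrite big_mkcond; apply: eq_bigr => i _; rewrite scalerA ltnS.
by case: leqP => ki; [congr (_ *: _); ring | rewrite bin_small // !mulr0 scale0r].
Qed.

Lemma koszul_num_coef h i : (koszul_num h)`_i = if (i < r.+1)%N then (-1) ^+ i * h i else 0.
Proof.
rewrite coef_sum; case: ltnP => ir; last first.
  by rewrite big1 // => k _; rewrite coefZ coefXn gtn_eqF ?mulr0 // (leq_trans (ltn_ord k)).
rewrite (bigD1 (Ordinal ir)) //= coefZ coefXn eqxx mulr1 big1 ?addr0 // => k.
by rewrite coefZ coefXn -val_eqE eq_sym => /negPf /= ->; rewrite mulr0.
Qed.

(** In powers of 1 - t the numerator is constant exactly when it is in powers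
    of t. *)
Lemma expansion_coef_eq0 h :
  (forall i, (0 < i <= r)%N -> expansion_coef h i = 0) <->
  (forall i, (0 < i <= r)%N -> h i = 0).
Proof.
split=> H i /andP[i0 ir]; last first.
  rewrite /expansion_coef big_nat_cond big1 // => k /andP[/andP[ik kr] _].
  by rewrite H ?mulr0 ?mul0r // (leq_trans i0 ik).
have /(congr1 (fun p : {poly int} => p`_i)) := koszul_num_expansion h.
rewrite koszul_num_coef ltnS ir /expansion_num big_ord_recl big1 => [|k _]; last first.
  by rewrite H ?mulr0 ?scale0r //= /bump leq0n add1n ltn_ord.
rewrite !expr0 mul1r addr0 alg_polyC coefC gtn_eqF //.
move/(congr1 ( *%R ((-1) ^+ i))); rewrite mulr0 mulrA -exprMn mulrNN mulr1 expr1n.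
by rewrite mul1r.
Qed.

(** The binomial theorem: the Koszul numbers C(r, i) l of a module of length l
    killed by the sequence contribute l (1 - t)^r. *)
Lemma koszul_num_rec h h' (l : int) :
  (forall i, h i = h' i + 'C(r, i)%:Z * l) ->
  koszul_num h = koszul_num h' + l *: (1 - 'X) ^+ r.
Proof.
move=> hh; rewrite exprBn scaler_sumr -big_split; apply: eq_bigr => i _ /=.
rewrite hh expr1n mulr1 -scaler_nat natz -!mul_polyC !rmorphM !rmorphD.
rewrite !rmorphM rmorphXn rmorphN1.
ring.
Qed.

End Expansions.

Lemma koszul_num_widen r h : h r.+1 = 0 -> koszul_num r.+1 h = koszul_num r h.
Proof. by move=> h0; rewrite /koszul_num big_ord_recr /= h0 mulr0 scale0r addr0. Qed.

(** * Polynomials agreeing eventually with a function *)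

Section EventualPolynomials.

(** The difference of the two polynomials has more roots than its size. *)
Lemma agrees_eventually_uniq f p q :
  agrees_eventually f p -> agrees_eventually f q -> p = q.
Proof.
move=> [a pa] [b qb]; apply/eqP; rewrite -subr_eq0; apply/eqP.
pose N := maxn a b; pose s := [seq (N + i)%:R : rat | i <- iota 0 (size (p - q))].
apply: (@roots_geq_poly_eq0 _ _ s); last by rewrite size_map size_iota.
  apply/allP => _ /mapP[i _ ->]; rewrite /root hornerD hornerN pa ?qb ?subrr //.
    by rewrite (leq_trans (leq_maxr a b)) // leq_addr.
  by rewrite (leq_trans (leq_maxl a b)) // leq_addr.
rewrite map_inj_uniq ?iota_uniq // => i j /eqP.
by rewrite Num.Theory.eqr_nat eqn_add2l => /eqP.
Qed.

Lemma horner_binp k n : (binp k).[n%:R] = ('C(n + k, k))%:R.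
Proof.
have e : (\prod_(l < k) (n + l.+1) = 'C(n + k, k) * k`!)%N.
  elim: k => [|k IH]; first by rewrite big_ord0 bin0.
  rewrite big_ord_recr /= IH factS mulnA [('C(n + k.+1, _) * _)%N]mulnC -mul_bin_diag.
  by rewrite addnS /= mulnAC [(_.+1 * _)%N]mulnC.
rewrite /binp hornerZ horner_prod.
under eq_bigr do rewrite hornerD hornerX hornerC -natrD.
rewrite -natr_prod e natrM mulrC mulfK // Num.Theory.pnatr_eq0 -lt0n fact_gt0 //.
Qed.

Lemma horner_binp_expansion r (c : 'I_r.+1 -> int) n : (binp_expansion c).[n%:R] =
  (\sum_(i < r.+1) ((-1) ^+ i * c i) * 'C(n + (r - i), r - i)%:Z)%:~R.
Proof.
rewrite /binp_expansion horner_sum rmorph_sum; apply: eq_bigr => i _ /=.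
by rewrite hornerZ horner_binp !rmorphM rmorphXn rmorphN1.
Qed.

(** The coefficients can be read off the generating series of the values. *)
Lemma binp_expansion_inj r (c c' : {ffun 'I_r.+1 -> int}) :
  binp_expansion c = binp_expansion c' -> c = c'.
Proof.
move=> e; apply/ffunP; apply: expansion_num_inj.
apply: is_series_num (is_series_expansion c) _.
apply: is_series_ext (is_series_expansion c') => n; apply/eqP.
by rewrite -(eqr_int rat) -!horner_binp_expansion e.
Qed.

End EventualPolynomials.

(** * The Hilbert series of the torsion of the associated graded module *)

Section HilbertSeries.
Variables (R : comNzRingType) (V : lmodType R) (m : set R).
Hypotheses (R_noetherian : noetherian R) (R_local : local_ring m).
Hypothesis (V_finite : finite_module V).
Implicit Types (L N : set V) (s : seq R).
Local Open Scope classical_set_scope.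

(** s is a regular sequence on V / L, up to the condition (s)V + L <> V. *)
Fixpoint regular L s : Prop :=
  if s is x :: s' then
    (forall v, L (x *: v) -> L v) /\ regular (gen [:: x] setT L) s'
  else True.

Lemma diff_sum (g : nat -> nat) n :
  diff (fun k => (\sum_(i < k.+1) g i)%N%:Z) n = (g n)%:Z.
Proof.
rewrite /diff; case: n => [|n]; first by rewrite big_ord1 subr0.
by rewrite big_ord_recr /= PoszD addrAC subrr add0r.
Qed.

Lemma is_series_partial_sums (g : nat -> nat) p r :
  is_series_of (fun k => (g k)%:Z) p ((1 - 'X) ^+ r) ->
  is_series_of (fun k => (\sum_(i < k.+1) g i)%N%:Z) p ((1 - 'X) ^+ r.+1).
Proof.
move=> Hg; apply/is_series_diff; apply: is_series_ext Hg => n.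
by rewrite diff_sum.
Qed.

(** The induction behind the theorem. With l the length of N / L, the step from
    V / N' to V / L adds C(r + 1, i) l to h_i, and turns g into its sequence of
    partial sums with l added in degree zero; regularity of the head means l = 0,
    which h_(r+1) = l detects. *)
Lemma koszul_gr_series r (x : r.-tuple R) L : submodule L -> dseq L x ->
  (forall p, exists n, koszul_length x L p.+1 n) ->
  torsion_generated m x L /\
  exists h g : nat -> nat,
  [/\ forall p, koszul_length x L p.+1 (h p.+1),
      forall k, gr_length m x L k (g k), h 0%N = g 0%N,
      forall p, (r < p)%N -> h p = 0%N &
      is_series_of (fun k => (g k)%:Z) (koszul_num r (fun i => (h i)%:Z))
        ((1 - 'X) ^+ r) /\
      ((forall i, (0 < i <= r)%N -> h i = 0%N) <-> regular L x)].
Proof.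
elim: r x L => [|r IH] x L sL.
  rewrite (tuple0 x) => _ _; split.
    by move=> [|k] v [Lv Tv]; [exact: Tv | exact: Lv].
  have [n hn] := torsion_finite_length R_noetherian R_local V_finite sL.
  pose h (i : nat) := if i == 0%N then n else 0%N.
  exists h, h; split=> //.
  - by move=> p; apply: koszul_length_nil.
  - move=> [|k]; first by rewrite /gr_length setTI.
    rewrite /gr_length (_ : _ `&` _ = L); first exact: has_length_refl.
    by apply/seteqP; split=> [v []//|v Lv]; split=> //; apply: torsion_sup.
  - by case.
  split; last by split=> // _ [].
  rewrite expr0; apply/is_series0 => k; rewrite koszul_num_coef ltnS leqn0 /h.
  by case: eqP => [->|]; rewrite ?mul1r.
case/tupleP: x => x0 x ds hK.
set N := colon_head L x0; set N' := gen [:: x0] setT N.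
have sN : submodule N by apply: submodule_colon_head.
have sN' : submodule N' by apply: submodule_quo_head.
have LN : L `<=` N by apply: colon_head_sup.
have [l hl] : exists l, has_length N L l.
  by have [n /(koszul_length_colon_exists sL ds)] := hK r.
have kN := finite_length_killed R_local sN sL LN hl.
have [|tg [h' [g' [hh' hg' h0 h'r [ser reg]]]]] := IH x N' sN' (dseq_quo_head sL ds).
  by move=> p; have [n /(koszul_length_quo_exists sL ds)] := hK p.
have tgN := torsion_generated_regular sL ds tg.
split; first exact: torsion_generated_colon kN tgN.
pose gN k := (\sum_(i < k.+1) g' i)%N.
have hgN k : gr_length m (x0 :: x) N k (gN k).
  elim: k => [|k IHk]; first by rewrite /gN big_ord1; apply: hg'.
  by rewrite /gN big_ord_recr /= addnC; apply: gr_length_quoS.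
exists (fun i => h' i + 'C(r.+1, i) * l)%N, (fun k => gN k + (if k == 0%N then l else 0))%N.
split.
- by move=> p; apply: koszul_length_cons.
- move=> [|k]; first exact: gr_length_colon0 kN _ _ hl (hgN _).
  by rewrite addn0; apply/(gr_length_colonS sL ds kN).
- by rewrite /gN big_ord1 h0 bin0 mul1n.
- by move=> p rp; rewrite bin_small // h'r // ltnW.
split.
  have h'r1 : (h' r.+1)%:Z = 0 by rewrite h'r.
  rewrite (@koszul_num_rec _ _ (fun i => (h' i)%:Z) l%:Z) => [|i]; last first.
    by rewrite PoszD PoszM.
  rewrite koszul_num_widen //.
  apply: (is_series_ext (u := fun k => (gN k)%:Z + (if k == 0%N then l%:Z else 0))).
    by move=> k; rewrite PoszD; case: eqP.
  apply: is_seriesD; first exact: is_series_partial_sums.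
  exact: is_series_const.
split=> [hz|[reg0 /= regL]].
  have l0 : l = 0%N.
    by have := hz r.+1; rewrite ltnS leqnn binn mul1n h'r // add0n; apply.
  have eN : N = L by apply: has_length0 => //; rewrite -l0.
  have regN' : regular N' x.
    apply/reg => i /andP[i0 ir].
    by have := hz i; rewrite i0 leqW // l0 muln0 addn0; apply.
  by split=> [v|] /=; [rewrite -[in X in _ -> X]eN | rewrite -eN].
have eN : N = L by apply/seteqP; split=> // v /reg0.
have l0 : l = 0%N by apply: has_length_uniq hl _; rewrite eN; apply: has_length_refl.
have hz : forall i, (0 < i <= r)%N -> h' i = 0%N by apply/reg; rewrite /N' eN.
move=> i /andP[i0 ir]; rewrite l0 muln0 addn0.
have [->|nir] := eqVneq i r.+1; first exact: h'r.
by apply: hz; rewrite i0 -ltnS ltn_neqAle nir.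
Qed.

End HilbertSeries.

(** * The invariants of the theorem *)

Section Comparison.
Variables (R : comNzRingType) (V : lmodType R) (m : set R).
Implicit Types (L N A : set V) (s : seq R).
Local Open Scope classical_set_scope.

Lemma submodule_ideal_smul (I : set R) A :
  submodule (I : set R^o) -> submodule A -> submodule (ideal_smul I A).
Proof.
move=> sI sA; apply/submoduleP; split.
  exists 0%N, (fun=> 0), (fun=> 0); split=> [[]//|[]//|].
  by rewrite big_ord0.
move=> a u v [n [b [w [Ib Aw ->]]]] [n' [b' [w' [Ib' Aw' ->]]]].
exists (n + n')%N, (fun k => match split k with inl i => a * b i | inr i => b' i end),
  (fun k => match split k with inl i => w i | inr i => w' i end); split.
- by move=> k; case: (split k) => i //; apply: (subZ a sI).
- by move=> k; case: (split k).
rewrite big_split_ord /= scaler_sumr; congr (_ + _); apply: eq_bigr => i _.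
  by rewrite (unsplitK (inl i)) scalerA.
by rewrite (unsplitK (inr i)).
Qed.

Lemma ideal_smul_gen s A : submodule A ->
  ideal_smul (ideal_gen s) A = gen s A [set 0].
Proof.
move=> sA; have sg : submodule (gen s A [set (0 : V)]) by apply: submodule_gen.
rewrite /ideal_gen lspan_generated; apply/seteqP; split.
  move=> _ [n [a [w [Ia Aw ->]]]]; apply: sub_sum => // i _.
  apply: (Ia i [set c : R | gen s A [set 0] (c *: w i)]).
    exact: submodule_colon_elt.
  by move=> c cs; apply: gen_mul.
have si := submodule_ideal_smul (@submodule_generated _ R^o s) sA.
apply: gen_sub => // [v ->|a u aS Au]; first exact: sub0.
exists 1%N, (fun=> a), (fun=> u); split=> //; last by rewrite big_ord1.
by move=> _; apply: (@mem_generated _ R^o).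
Qed.

Lemma seq_smul_gen s : seq_smul V s = gen s setT [set 0].
Proof. exact: ideal_smul_gen. Qed.

Lemma pow_smul_filt s k : pow_smul V (ideal_gen s) k = filt s [set 0] setT k.
Proof.
elim: k => // k IH.
rewrite -[LHS]/(ideal_smul (ideal_gen s) (pow_smul V (ideal_gen s) k)) IH.
rewrite ideal_smul_gen //.
exact: submodule_filt.
Qed.

Lemma H0m_torsion (W : lmodType R) (A C : set W) : submodule C ->
  H0m m (SubQuo A C) = SubQuo (A `&` torsion m C) C.
Proof. by move=> sC; rewrite torsion_pow. Qed.

Lemma j_transform_filt s k : j_transform V m (ideal_gen s) k =
  SubQuo (filt s [set 0] setT k `&` filt_torsion m s [set 0] k.+1)
         (filt s [set 0] setT k.+1).
Proof.
by rewrite /j_transform /gr !pow_smul_filt H0m_torsion //; apply: submodule_filt.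
Qed.

Lemma koszul_homology_rel r (x : r.-tuple R) p :
  koszul_homology V x p = SubQuo (koszul_cyc x [set 0] p) (koszul_bnd x [set 0] p).
Proof.
rewrite /koszul_homology; congr SubQuo; apply/seteqP; split=> f.
- by move=> [fp df]; split=> //= T; rewrite df ffunE.
- by move=> [fp df]; split=> //=; apply/ffunP => T; rewrite df ffunE.
- move=> [g gp <-]; split; first exact: koszul_d_chains.
  by exists g => // T; rewrite subrr ffunE.
- move=> [fp [g gp fg]]; exists g => //; apply/esym/eqP; rewrite -subr_eq0.
  by apply/eqP/ffunP => T; rewrite fg ffunE.
Qed.

(** H_0 of the Koszul complex lives on functions on subsets: it is identified with
    V / (I V + L) by extending a vector by zero from the empty subset. *)
Section DegreeZero.
Variables (r : nat) (x : r.-tuple R) (L : set V).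
Hypothesis (sL : submodule L).

Definition koszul_const (v : V) : koszul_space V r :=
  [ffun T : {set 'I_r} => if T == finset.set0 then v else 0].

Lemma linear_koszul_const : linear koszul_const.
Proof.
move=> a u v; apply/ffunP => T; rewrite !ffunE; case: eqP => // _.
by rewrite scaler0 addr0.
Qed.

Lemma koszul_const_chains v : koszul_chains 0 (koszul_const v).
Proof. by move=> T; rewrite ffunE cards_eq0 => /negPf ->. Qed.

Lemma koszul_chains0 f : koszul_chains 0 f -> f = koszul_const (f finset.set0).
Proof.
move=> f0; apply/ffunP => T; rewrite ffunE; case: eqP => [->//|/eqP nT].
by rewrite f0 // cards_eq0.
Qed.

Lemma koszul_cyc0 : koszul_cyc x L 0 = @koszul_chains R V r 0.
Proof.
apply/seteqP; split=> [f []//|f f0]; split=> // T; rewrite ffunE big1 => [|i _].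
  exact: sub0.
by rewrite f0 ?scaler0 // cards_eq0; apply/set0Pn; exists i; rewrite finset.setU11.
Qed.

Lemma koszul_const_bnd : koszul_const @^-1` koszul_bnd x L 0 = gen x setT L.
Proof.
have sb := submodule_koszul_bnd x 0 sL; apply/seteqP; split=> [v [_ [g _ Lg]]|].
  have := Lg finset.set0; rewrite !ffunE eqxx => /(@gen_sup _ _ x setT L (@submodule_setT _ _)).
  have := koszul_d_gen x g sL finset.set0; rewrite ffunE.
  by move=> gd; apply: subBr gd; apply: submodule_gen.
apply: gen_sub => [|v Lv|a u /tnthP[i ->] _].
- by apply: submodule_preim => //; apply: linear_koszul_const.
- split; first exact: koszul_const_chains.
  exists 0 => [T _|T]; first by rewrite ffunE.
  rewrite (lin0 (@linear_koszul_d _ _ _ x)) subr0 ffunE; case: eqP => // _.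
  exact: sub0.
split; first exact: koszul_const_chains.
pose g : koszul_space V r := [ffun T : {set 'I_r} => if T == [set i]%SET then u else 0].
have g1 : koszul_chains 1 g.
  by move=> T; rewrite ffunE; case: (T =P _) => // ->; rewrite cards1.
exists g => // T; suff -> : koszul_const (tnth x i *: u) = koszul_d x g.
  by rewrite subrr ffunE; apply: sub0.
rewrite [RHS]koszul_chains0; last exact: koszul_d_chains.
congr koszul_const; rewrite ffunE (bigD1 i) ?inE //= big1 ?addr0 => [|j /andP[_ ji]].
  rewrite ffunE finset.setU0 eqxx (_ : #|_| = 0%N) ?expr0 ?mul1r //.
  by apply: eq_card0 => j; rewrite !inE.
by rewrite ffunE finset.setU0 (inj_eq finset.set1_inj) (negPf ji) scaler0.
Qed.

Lemma killed_preim (W : lmodType R) (phi : V -> W) k (C : set W) : linear phi ->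
  phi @^-1` killed m k C = killed m k (phi @^-1` C).
Proof.
move=> lphi; elim: k => //= k IH; apply/seteqP; split=> v H b mb.
  by rewrite -IH /preimage /= (linZ _ _ lphi); apply: H.
by rewrite -(linZ _ _ lphi); have := H b mb; rewrite -IH.
Qed.

Lemma gr_length0_koszul n : gr_length m x L 0 n ->
  has_length (koszul_cyc x L 0 `&` torsion m (koszul_bnd x L 0)) (koszul_bnd x L 0) n.
Proof.
have sb := submodule_koszul_bnd x 0 sL.
have lc := linear_koszul_const.
have tor v : torsion m (koszul_bnd x L 0) (koszul_const v) <-> torsion m (gen x setT L) v.
  rewrite -koszul_const_bnd; split=> -[k kv]; exists k.
    by rewrite -killed_preim.
  by have := kv; rewrite -killed_preim.
have sg : submodule (gen x setT L) by apply: submodule_gen.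
apply: (has_length_image (phi := koszul_const)) => //.
- by apply: submoduleI => //; apply: submodule_torsion.
- by apply: submoduleI; [exact: submodule_koszul_cyc | exact: submodule_torsion].
- by move=> v gv; split=> //; apply: torsion_sup.
- by move=> f fb; split; [exact: koszul_bnd_cyc | exact: torsion_sup].
- move=> v [_ Tv]; split; last exact/tor.
  by rewrite koszul_cyc0; apply: koszul_const_chains.
- by move=> v _; rewrite -[koszul_bnd x L 0 _]/((koszul_const @^-1` koszul_bnd x L 0) v)
    koszul_const_bnd.
move=> f []; rewrite koszul_cyc0 => /koszul_chains0 -> /tor Tf.
exists (f finset.set0); first by split.
by rewrite subrr; apply: sub0.
Qed.

End DegreeZero.

(** gen (take i s) setT L is the submodule by which the recursion of [dseq] divides
    at its i-th step. *)
Lemma dseq_of_colon s L :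
  (forall i j v, (i <= j < size s)%N ->
     gen (take i s) setT L ((s`_i * s`_j) *: v) -> gen (take i s) setT L (s`_j *: v)) ->
  dseq L s.
Proof.
elim: s L => //= a s IH L H; split.
  move=> y v yS; have ys : (index y (a :: s) < (size s).+1)%N by rewrite index_mem.
  have := H 0%N (index y (a :: s)) v; rewrite nth_index // scalerA.
  by apply; rewrite leq0n.
by apply: IH => i j v ij; apply: (H i.+1 j.+1).
Qed.

Lemma regularP s L :
  (forall i v, (i < size s)%N ->
     gen (take i s) setT L (s`_i *: v) -> gen (take i s) setT L v) <-> regular L s.
Proof.
elim: s L => [|a s IH] L /=; first by split=> // _ i v.
split=> [H|[H0 /IH H] [|i] v]; last first.
- exact: H.
- by move=> _; apply: H0.
by split; [move=> v; apply: (H 0%N) | apply/IH => i v; apply: (H i.+1)].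
Qed.

Lemma d_sequence_dseq r (x : r.-tuple R) : d_sequence V x -> dseq [set (0 : V)] x.
Proof.
move=> ds; apply: dseq_of_colon => i j v /andP[ij]; rewrite size_tuple => jr.
have ir := leq_ltn_trans ij jr.
have /seteqP[+ _] := ds (Ordinal ir) (Ordinal jr) ij => /(_ v).
by rewrite /colon /= seq_smul_gen !(tnth_nth 0).
Qed.

Lemma regular_sequenceE r (x : r.-tuple R) : seq_smul V x <> setT ->
  regular_sequence V x <-> regular [set (0 : V)] x.
Proof.
move=> nT; rewrite -regularP; split=> [[H _] i v|H].
  rewrite size_tuple => ir; have /seteqP[+ _] := H (Ordinal ir) => /(_ v).
  by rewrite /colon /= seq_smul_gen (tnth_nth 0).
split=> // i; rewrite seq_smul_gen (tnth_nth 0); apply/seteqP; split=> v.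
  by apply: H; rewrite size_tuple.
by apply: subZ; apply: submodule_gen.
Qed.

(** The prime ideals entering the Krull dimension are proper and contain the
    annihilator, so a quotient that has a dimension is nonzero. *)
Lemma is_dim_proper (N : set V) e : is_dim (quo N) e -> N <> setT.
Proof.
move=> [[C [CP _]] _] eN; have [[/proper_idealP[_ C1] _] annC] := CP 0%N isT.
by apply: C1; apply: annC => v _; rewrite /= eN.
Qed.

End Comparison.

Theorem corollary3p4 (R : comNzRingType) (m : set R) (M : lmodType R)
    (d r : nat) (x : r.-tuple R)
    (R_noetherian : noetherian R) (R_local : local_ring m)
    (M_finite : finite_module M) (M_dim : is_dim (whole M) d) (d_gt0 : (0 < d)%N)
    (r_le_d : (r <= d)%N)
    (x_psop : partial_sop M m x) (x_amenable : amenable M x)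
    (x_dseq : d_sequence M x) :
  let I := ideal_gen x in
  let h := koszul_h M m x in
  let j := j_coef M m x in
  [/\
      [/\ forall k, finite_length (j_transform M m I k),
          is_series_of (fun k => (j_hilbert M m I k)%:Z)
            (\sum_(i < r.+1) ((-1) ^+ i * (h i)%:Z) *: 'X^i)
            ((1 - 'X) ^+ r),
          agrees_eventually (j_function M m I) (j_polynomial M m I) &
          j_polynomial M m I = binp_expansion j],
      forall i : 'I_r.+1,
        j i = \sum_(i <= k < r.+1) (-1) ^+ k * (h k)%:Z * ('C(k, i))%:Z,
      j ord0 = \sum_(0 <= k < r.+1) (-1) ^+ k * (h k)%:Z,
      forall i : 'I_r.+1, i = 1%N :> nat ->
        j i = \sum_(1 <= k < r.+1) (-1) ^+ k * k%:Z * (h k)%:Z &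
      regular_sequence M x <->
        forall i : 'I_r.+1, (1 <= i)%N -> j i = 0].
Proof.
move=> I h j; set L := [set (0 : M)]%classic.
have sL : submodule L by apply: submodule_set0.
have hK p : exists n, koszul_length x L p.+1 n.
  have := x_amenable _ (ltn0Sn p).
  by rewrite koszul_homology_rel.
have [_ [h0 [g [hh hg h0g _ [ser reg]]]]] :=
  koszul_gr_series R_noetherian R_local M_finite sL (d_sequence_dseq x_dseq) hK.
have eh : h =1 h0.
  rewrite /h /koszul_h => -[|i] /=; last first.
    by rewrite koszul_homology_rel; apply: sq_length_eq; apply: hh.
  rewrite koszul_homology_rel H0m_torsion; last exact: submodule_koszul_bnd.
  apply: sq_length_eq.
  by rewrite h0g; apply: gr_length0_koszul.
have eg : j_hilbert M m I =1 g.
  by move=> k; rewrite /j_hilbert /I j_transform_filt; apply: sq_length_eq; apply: hg.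
have hz : koszul_num r (fun i => (h i)%:Z) = koszul_num r (fun i => (h0 i)%:Z).
  by apply: eq_bigr => i _; rewrite eh.
have serj : is_series_of (fun k => (j_hilbert M m I k)%:Z)
    (koszul_num r (fun i => (h i)%:Z)) ((1 - 'X) ^+ r).
  by rewrite hz; apply: is_series_ext ser => k; rewrite eg.
pose c : {ffun 'I_r.+1 -> int} := [ffun i : 'I_r.+1 => expansion_coef r (fun k => (h k)%:Z) i].
have psi : is_series_of (fun n => (j_function M m I n)%:Z) (expansion_num c)
    ((1 - 'X) ^+ r.+1).
  rewrite (_ : expansion_num c = koszul_num r (fun i => (h i)%:Z)).
    exact: is_series_partial_sums.
  by rewrite koszul_num_expansion; apply: eq_bigr => i _; rewrite ffunE.
have agr : agrees_eventually (j_function M m I) (binp_expansion c).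
  exists 0%N => n _; rewrite horner_binp_expansion [RHS]pmulrn.
  by rewrite (is_series_uniq (is_series_expansion c) psi n).
have ejp : j_polynomial M m I = binp_expansion c.
  rewrite /j_polynomial; case: xgetP => [p _ /= hp|/(_ _ agr)] //.
  exact: agrees_eventually_uniq hp agr.
have ej : j = c.
  rewrite /j /j_coef; case: xgetP => [c' _ /= hc'|/(_ c) /=]; last by rewrite ejp.
  by apply: binp_expansion_inj; rewrite -hc' ejp.
have nT : seq_smul M x <> setT by case: x_psop => _ [e [_ /is_dim_proper]].
split.
- split=> //; last by rewrite ejp ej.
    by move=> k; rewrite /I j_transform_filt; exists (g k); apply: hg.
  by rewrite ejp.
- by move=> i; rewrite ej ffunE.
- rewrite ej ffunE; apply: eq_bigr => k _; by rewrite bin0 mulr1.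
- move=> i i1; rewrite ej ffunE i1; apply: eq_bigr => k _.
  by rewrite bin1 mulrAC.
rewrite (regular_sequenceE nT) -reg ej; split=> [z i i1|z i /andP[i0 ir]].
  rewrite ffunE; apply: (iffRL (expansion_coef_eq0 r _)); last by rewrite i1 -ltnS /=.
  by move=> k kr; rewrite eh z.
suff /eqP : (h i)%:Z = 0 by rewrite eh eqz_nat => /eqP.
apply: (iffLR (expansion_coef_eq0 r (fun k => (h k)%:Z))); last by rewrite i0.
move=> k /andP[k0 kr]; have := z (Ordinal (kr : (k < r.+1)%N)) k0.
by rewrite ffunE.
Qed.
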